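(* Let $H$ be a hyperplane defining $P$ with $\bar x\notin H$, and let $\mathcal R^c\subseteq\bar{\mathcal R}$ be the set of rays previously cut. Let $\tilde H$ be a hyperplane obtained via a targeted tilting of $H$ on a set of rays $\mathcal R'\subseteq\bar{\mathcal R}(H)$ such that $\mathcal R^c\cap\bar{\mathcal R}(H)\subseteq\mathcal R'$. Given a proper point-ray collection $(\mathcal P,\mathcal R)$, the point-ray collection returned by $\mathrm{PHA}_1(P,S,H,\mathcal R',(\mathcal P,\mathcal R))$ is proper.
   Context: Setting. $P=\{x\in\mathbb R^n: Ax\ge b,\ x\ge 0\}$ (rational data) is a full-dimensional pointed polyhedron, $I\subseteq\{1,\dots,n\}$, $P_I=\{x\in P: x_j\in\mathbb Z \text{ for all } j\in I\}$. For $c\in\mathbb Q^n$, $\bar x$ is an optimal basic feasible solution of $\min\{c^{T}x: x\in P\}$. $\bar C$ is the (simplicial) polyhedral cone with apex $\bar x$ defined by the $n$ hyperplanes corresponding to the nonbasic variables at $\bar x$; $\bar{\mathcal H}$ is the set of these $n$ hyperplanes and $\bar{\mathcal R}$ is the set of the $n$ extreme rays of $\bar C$ (each $r\in\bar{\mathcal R}$ is viewed both as a direction and as the half-line $\{\bar x+tr: t\ge0\}$). $S$ is a closed convex set with no point of $P_I$ in its interior and with $\bar x\in\operatorname{int}S$. Point-ray collections. A point-ray collection $(\mathcal P,\mathcal R)$ is a finite set $\mathcal P$ of points on $\operatorname{bd}S$ and a finite set $\mathcal R$ of rays (directions), contained in $\bar C$, where each element arises from intersecting an edge of some relaxation of $P$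 with $\operatorname{bd}S$: an intersection point of the edge with $\operatorname{bd}S$, or, if an unbounded edge does not meet $\operatorname{bd}S$, the direction of that edge. The edge producing each element is remembered; if the starting vertex of that edge lies on a ray $r\in\bar{\mathcal R}$, the element is said to originate from (a vertex on) $r$. The collection is proper if $\alpha^{T}x\ge\beta$ is valid for $P_I$ for every $(\alpha,\beta)\in\mathbb R^n\times\mathbb R$ with $\alpha^{T}p\ge\beta$ for all $p\in\mathcal P$, $\alpha^{T}\rho\ge0$ for all $\rho\in\mathcal R$, and $\alpha^{T}\bar x<\beta$. The initial collection $(\mathcal P_0,\mathcal R_0)$ consists of the points $r\cap\operatorname{bd}S$ for the $r\in\bar{\mathcal R}$ meeting $\operatorname{bd}S$, and of the rays $r\in\bar{\mathcal R}$ not meeting $\operatorname{bd}S$. Distances. For a hyperplane $H_h=\{x:a_h^{T}x=b_h\}$ with $H_h^+=\{x:a_h^{T}x\ge b_h\}\supseteq P$ and $r\in\bar{\mathcal R}$, $\mathrm{dist}(H_h,r)=(b_h-a_h^{T}\bar x)/(a_h^{T}r)$ if $a_h^{T}r<0$, and $\infty$ otherwise. $\mathrm{dist}(\operatorname{bd}S,r)$ is the distance from $\bar x$ along $r$ to $\operatorname{bd}S$ ($\infty$ if $r$ does not meet $\operatorname{bd}S$). $\bar{\mathcal R}(H)=\{r\in\bar{\mathcal R}:\mathrm{dist}(H,r)<\mathrm{dist}(\operatorname{bd}S,r)\}$ is the set of rays of $\bar C$ intersected by $H$ before $\operatorname{bd}S$. $\mathcal H(r)\subseteq\bar{\mathcal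 H}$ denotes the $n-1$ hyperplanes of $\bar{\mathcal H}$ that define (contain) $r$. Algorithm $\mathrm{PHA}_1(P,S,H_h,\mathcal R_A,(\mathcal P,\mathcal R))$, where $H_h^+\supseteq P$ and $\mathcal R_A\subseteq\bar{\mathcal R}$: For every $r\in\mathcal R_A$ with $\mathrm{dist}(H_h,r)<\mathrm{dist}(\operatorname{bd}S,r)$ do the following. (i) Remove all points and rays in $(\mathcal P,\mathcal R)$ that violate $H_h^+$ (for a point $p$: $a_h^{T}p<b_h$; for a ray $\rho$: $a_h^{T}\rho<0$) and originate from a vertex on $r$, but that do not lie on or coincide with any ray from $\bar{\mathcal R}\setminus\mathcal R_A$. (ii) For every new edge $e$ originating at the vertex $r\cap H_h$ (that is, every edge of $\bar C\cap H_h^+$ that lies on $H_h$ and emanates from $r\cap H_h$): if $e$ does not intersect any hyperplane in $\bar{\mathcal H}\setminus\mathcal H(r)$ prior to $\operatorname{bd}S$, then add the intersection point of $e$ with $\operatorname{bd}S$ to $\mathcal P$ if $e\cap\operatorname{bd}S\neq\emptyset$, and otherwise add the ray $e$ to $\mathcal R$. Finally return $(\mathcal P,\mathcal R)$. Rays previously cut. The collection $(\mathcal P,\mathcal R)$ has been built from $(\mathcal P_0,\mathcal R_0)$ by earlier hyperplane activations (calls of $\mathrm{PHA}_1$); a ray $r\in\bar{\mathcal R}$ has been previously cut if in some earlier call it belonged to the ray set $\mathcal R_A$ of that call and was intersected by the activated hyperplane before $\operatorname{bd}S$. Targeted tilting. For $r\in\bar{\mathcal R}$, let $v(H,r)$ be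 the intersection point of the line $\bar x+\mathbb R r$ with $H$ if it exists, and $v(H,r)=r$ (a direction) otherwise; let $v(\operatorname{bd}S,r)$ be the intersection point of the ray $r$ with $\operatorname{bd}S$ if it exists, and $v(\operatorname{bd}S,r)=r$ otherwise. For $\mathcal R'\subseteq\bar{\mathcal R}(H)$, the targeted tilting $\tilde H$ of $H$ with respect to (on) $\mathcal R'$ is the unique hyperplane going through $v(\operatorname{bd}S,r)$ for all $r\in\bar{\mathcal R}(H)\setminus\mathcal R'$ and through $v(H,r)$ for all other $r\in\bar{\mathcal R}$ (going through a direction means being parallel to it). *)

(* Defs.v *)
From HB Require Import structures.
From mathcomp Require Import all_boot all_order all_algebra.
From mathcomp Require Import all_classical all_reals all_analysis.

Set Implicit Arguments.
Unset Strict Implicit.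
Unset Printing Implicit Defensive.

Import Order.TTheory GRing.Theory Num.Theory.
Import numFieldNormedType.Exports.

Local Open Scope classical_set_scope.
Local Open Scope ring_scope.

Section Geometry.
Context {R : realType} {n : nat}.
Local Notation vec := 'cV[R]_n.

Definition dot (u v : vec) : R := \sum_i u i 0 * v i 0.

Record hyperplane := Hyperplane { normal : vec; offset : R }.

Definition hset (H : hyperplane) : set vec :=
  [set x | dot (normal H) x = offset H].
Definition hspace (H : hyperplane) : set vec :=
  [set x | offset H <= dot (normal H) x].

Definition bd (S : set vec) : set vec := closure S `\` S°.

Definition halfline (v d : vec) : set vec :=
  [set x | exists2 t : R, 0 <= t & x = v + t *: d].
Definition segment (v w : vec) : set vec :=
  [set x | exists2 t : R, 0 <= t <= 1 & x = v + t *: (w - v)].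

Definition cut_out (k : nat) (G : 'I_k -> hyperplane) : set vec :=
  [set x | forall i, hspace (G i) x].
Definition polyhedron (Q : set vec) : Prop :=
  exists k (G : 'I_k -> hyperplane), Q = cut_out G.
Definition relaxation (P Q : set vec) : Prop := polyhedron Q /\ P `<=` Q.

Definition face (Q F : set vec) : Prop :=
  exists H, Q `<=` hspace H /\ F = Q `&` hset H.

(* Edges are oriented: they are given by a starting vertex v and a direction d.
   A one-dimensional face of Q that starts at v in direction d is the whole
   part of Q on the half-line from v along d.  Directions are normalised to
   Euclidean length one, so that v and d are determined by the oriented edge. *)
Definition edge (Q : set vec) (v d : vec) : set vec := Q `&` halfline v d.
Definition edge_from (Q : set vec) (v d : vec) : Prop :=
  [/\ dot d d = 1, face Q (edge Q v d), Q v
    & exists2 t : R, 0 < t & Q (v + t *: d)].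

(* Dimension n: n + 1 affinely independent points. *)
Definition full_dimensional (Q : set vec) : Prop :=
  exists (x : vec) (X : 'M[R]_n),
    [/\ Q x, forall j, Q (x + col j X) & X \in unitmx].
Definition pointed (Q : set vec) : Prop :=
  ~ exists x d : vec, d != 0 /\ forall t : R, Q (x + t *: d).

Definition valid_hyperplane (P : set vec) (H : hyperplane) : Prop :=
  normal H != 0 /\ P `<=` hspace H.

End Geometry.

Arguments hyperplane : clear implicits.

Section PolyhedronData.
Context (R : realType) (m n : nat) (A : 'M[rat]_(m, n)) (b : 'cV[rat]_m).

(* The variables of the standard form: inl i is the slack of row i of
   A x >= b, inr j is x_j; each one is nonnegative on one side of the
   hyperplane below. *)
Definition constr (k : 'I_m + 'I_n) : hyperplane R n :=
  match k with
  | inl i => Hyperplane (\col_j ratr (A i j)) (ratr (b i 0))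
  | inr j => Hyperplane (delta_mx j 0) 0
  end.

Definition feasible_set : set 'cV[R]_n := [set x | forall k, hspace (constr k) x].

Definition mixed_int (I : {set 'I_n}) : set 'cV[R]_n :=
  [set x | feasible_set x /\ forall j, j \in I -> x j 0 \is a Num.int].

(* nb enumerates the nonbasic variables. *)
Definition basic_feasible (nb : 'I_n -> 'I_m + 'I_n) (x : 'cV[R]_n) : Prop :=
  [/\ feasible_set x, (\matrix_(i, j) normal (constr (nb i)) j 0) \in unitmx
    & forall i, hset (constr (nb i)) x].

Definition optimal_basic_feasible (c : 'cV[rat]_n)
    (nb : 'I_n -> 'I_m + 'I_n) (x : 'cV[R]_n) : Prop :=
  basic_feasible nb x /\
  forall y, feasible_set y -> dot (map_mx ratr c) x <= dot (map_mx ratr c) y.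

Definition nonbasic_hyperplanes (nb : 'I_n -> 'I_m + 'I_n) :
  'I_n -> hyperplane R n := fun i => constr (nb i).

End PolyhedronData.

Arguments constr R {m n} A b k.
Arguments feasible_set R {m n} A b.
Arguments mixed_int R {m n} A b I.
Arguments nonbasic_hyperplanes R {m n} A b nb.

Section Collections.
Context {R : realType} {n : nat}.
Local Notation vec := 'cV[R]_n.
Local Notation oriented_edge := (vec * vec)%type.

(* A point is recorded with the oriented edge (starting vertex, direction) that
   produced it; a ray is recorded as the oriented edge whose direction it is. *)
Record collection := Collection {
  points : set (oriented_edge * vec);
  rays : set oriented_edge }.

Context (Hbar : 'I_n -> hyperplane R n) (xbar : vec) (S : set vec).

Definition basis_cone : set vec := cut_out Hbar.

Definition Rbar : set vec := [set r | edge_from basis_cone xbar r].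

Definition dist_hyp (H : hyperplane R n) (r : vec) : \bar R :=
  if dot (normal H) r < 0
  then ((offset H - dot (normal H) xbar) / dot (normal H) r)%:E
  else +oo%E.

Definition dist_bd (r : vec) : \bar R :=
  ereal_inf [set t%:E | t in [set t : R | 0 <= t /\ bd S (xbar + t *: r)]].

Definition cut_before (H : hyperplane R n) (r : vec) : bool :=
  (dist_hyp H r < dist_bd r)%E.
Definition Rbar_cut (H : hyperplane R n) : set vec :=
  [set r | Rbar r /\ cut_before H r].

Definition defining (r : vec) : set 'I_n :=
  [set i | halfline xbar r `<=` hset (Hbar i)].

Definition originates (r : vec) (e : oriented_edge) : Prop :=
  halfline xbar r e.1.

Definition point_ray_collection (P : set vec) (C : collection) : Prop :=
  [/\ finite_set (points C) /\ finite_set (rays C),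
      forall v d p, points C ((v, d), p) ->
        [/\ bd S p, basis_cone p
          & exists Q, [/\ relaxation P Q, edge_from Q v d & edge Q v d p]]
    & forall v d, rays C (v, d) ->
        halfline xbar d `<=` basis_cone /\
        exists Q, [/\ relaxation P Q, edge_from Q v d,
                      edge Q v d = halfline v d
                    & edge Q v d `&` bd S = set0]].

Definition proper_collection (P PI : set vec) (C : collection) : Prop :=
  point_ray_collection P C /\
  forall (alpha : vec) (beta : R),
    (forall e p, points C (e, p) -> beta <= dot alpha p) ->
    (forall e, rays C e -> 0 <= dot alpha e.2) ->
    dot alpha xbar < beta ->
    forall x, PI x -> beta <= dot alpha x.

Definition initial_collection : collection := Collection
  [set q | [/\ q.1.1 = xbar, Rbar q.1.2, halfline xbar q.1.2 q.2 & bd S q.2]]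
  [set e | [/\ e.1 = xbar, Rbar e.2 & halfline xbar e.2 `&` bd S = set0]].

Definition new_edge (H : hyperplane R n) (r : vec) (e : oriented_edge) : Prop :=
  [/\ halfline xbar r e.1, hset H e.1,
      edge_from (basis_cone `&` hspace H) e.1 e.2
    & edge (basis_cone `&` hspace H) e.1 e.2 `<=` hset H].

Definition blocked (H : hyperplane R n) (r : vec) (e : oriented_edge) : Prop :=
  exists i x, [/\ ~ defining r i,
                  edge (basis_cone `&` hspace H) e.1 e.2 x,
                  hset (Hbar i) x
                & segment e.1 x `&` bd S = set0].

Definition removed_point (H : hyperplane R n) (RA : seq vec) (r : vec)
    (q : oriented_edge * vec) : Prop :=
  [/\ dot (normal H) q.2 < offset H, originates r q.1
    & ~ exists r', [/\ Rbar r', r' \notin RA & halfline xbar r' q.2]].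

Definition removed_ray (H : hyperplane R n) (RA : seq vec) (r : vec)
    (e : oriented_edge) : Prop :=
  [/\ dot (normal H) e.2 < 0, originates r e
    & ~ exists r', [/\ Rbar r', r' \notin RA & e.2 = r']].

Definition added_point (H : hyperplane R n) (r : vec)
    (q : oriented_edge * vec) : Prop :=
  [/\ new_edge H r q.1, ~ blocked H r q.1
    & (edge (basis_cone `&` hspace H) q.1.1 q.1.2 `&` bd S) q.2].

Definition added_ray (H : hyperplane R n) (r : vec) (e : oriented_edge) : Prop :=
  [/\ new_edge H r e, ~ blocked H r e
    & edge (basis_cone `&` hspace H) e.1 e.2 `&` bd S = set0].

Definition PHA1_step (H : hyperplane R n) (RA : seq vec) (C : collection)
    (r : vec) : collection :=
  if cut_before H r then
    Collection
      [set q | points C q /\ ~ removed_point H RA r q \/ added_point H r q]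
      [set e | rays C e /\ ~ removed_ray H RA r e \/ added_ray H r e]
  else C.

(* The sequence RA lists the set of rays in the order in which the loop visits
   them.  That order does not affect the result: whatever is added lies on H,
   resp. is parallel to H, and hence is not removed later in the loop. *)
Definition PHA1 (H : hyperplane R n) (RA : seq vec) (C : collection) :
  collection := foldl (PHA1_step H RA) C RA.

(* built P C Rc: C results from the initial collection by successive calls of
   PHA1, and Rc is the set of rays cut in these calls. *)
Inductive built (P : set vec) : collection -> set vec -> Prop :=
| built_initial : built P initial_collection set0
| built_PHA1 C Rc H RA :
    built P C Rc -> valid_hyperplane P H ->
    (forall r, r \in RA -> Rbar r) ->
    built P (PHA1 H RA C) (Rc `|` [set r | r \in RA /\ cut_before H r]).

(* A point (inl) or a direction (inr) that a hyperplane can go through. *)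
Definition goes_through (H : hyperplane R n) (v : vec + vec) : Prop :=
  match v with
  | inl p => hset H p
  | inr d => dot (normal H) d = 0
  end.

Definition v_hyp (H : hyperplane R n) (r : vec) : vec + vec :=
  if dot (normal H) r == 0 then inr r
  else inl (xbar +
         ((offset H - dot (normal H) xbar) / dot (normal H) r) *: r).

Definition v_bd (r : vec) : vec + vec :=
  if dist_bd r is t%:E%E then inl (xbar + t *: r) else inr r.

(* When xbar is not on H, at most one hyperplane (up to scaling of its
   equation) satisfies this. *)
Definition targeted_tilting (H : hyperplane R n) (R' : seq vec)
    (Ht : hyperplane R n) : Prop :=
  normal Ht != 0 /\
  forall r, Rbar r ->
    (Rbar_cut H r /\ r \notin R' -> goes_through Ht (v_bd r)) /\
    (~ (Rbar_cut H r /\ r \notin R') -> goes_through Ht (v_hyp H r)).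

End Collections.

Arguments collection : clear implicits.

(* Main.v *)
Require Import Defs.
From HB Require Import structures.
From mathcomp Require Import all_boot all_order all_algebra.
From mathcomp Require Import all_classical all_reals all_analysis.
From mathcomp Require Import ring lra.

(** Take the apex xbar as the origin. A cut that excludes it can be normalised
    to f >= 1 for a linear functional f, and H to eta = 1, where eta <= 1 on P
    (cutfun). The tilted hyperplane is likewise tilt = 1. Its coefficients on
    the rays of the cone are those of eta, except on the cut rays outside R',
    where they decrease to the inverse distance to bd S (tilt_coef_le); so
    tilt <= eta on the cone, and tilt <= 1 is valid for P.

    Every element of the collection starts at the apex and lies on a ray, or
    starts on a ray and lies in a plane spanned by it and another ray; moreover
    the initial elements of the rays never cut are still there
    (built_invariant). Consequently a removed element z lies in the plane of an
    activated ray i and a ray j, and tilt z >= 1, since otherwise z would be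
    interior to S (tilt_ge1; for directions, tilt z >= 0). What the activation
    adds is, in the plane of an activated ray i and of each uncut ray j, a point
    of H on bd S or a direction parallel to H (new_element).

    Let f be valid for the new collection. If f >= eta on all activated rays,
    convexity of S inside each plane shows that f is valid for the removed
    elements too (uncut_no_removed), and the properness of the old collection
    applies to f itself. Otherwise suppose f x < 1 for some x of P_I. As x is
    not interior to S, there is a functional s with s <= 1 on S and s x >= 1
    (supporting_functional). The new elements and the initial elements of the
    relaxed rays yield a constant c > 0 with s <= (1 - c) tilt + c f on the cone
    (tilt_interpolation). If c <= 1, this contradicts s x >= 1. If c > 1, put
    g = f + (f - s) / (c - 1). The inequality says that g >= tilt on the cone,
    so g is valid for the removed elements, and g >= f >= 1 on the others because
    s <= 1 on S. Thus g is valid for the old collection, which is proper, while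
    g x < 1: a contradiction (PHA1_valid). *)

Set Implicit Arguments.
Unset Strict Implicit.
Unset Printing Implicit Defensive.

Import Order.TTheory GRing.Theory Num.Theory.
Import numFieldNormedType.Exports.

Local Open Scope classical_set_scope.
Local Open Scope ring_scope.

Ltac vec_ring := apply/matrixP => ? ?; rewrite !mxE; ring.
Ltac vec_field := apply/matrixP => ? ?; rewrite !mxE; field.

(** * The dot product *)

Section DotProduct.
Context {R : realType} {n : nat}.
Local Notation vec := 'cV[R]_n.
Implicit Types u v w x : vec.

Lemma dotC u v : dot u v = dot v u.
Proof. by apply: eq_bigr => i _; rewrite mulrC. Qed.

Lemma dotDr u v w : dot u (v + w) = dot u v + dot u w.
Proof. by rewrite -big_split; apply: eq_bigr => i _; rewrite mxE mulrDr. Qed.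

Lemma dotZr u a v : dot u (a *: v) = a * dot u v.
Proof. by rewrite mulr_sumr; apply: eq_bigr => i _; rewrite mxE mulrCA. Qed.

Lemma dotDl u v w : dot (u + v) w = dot u w + dot v w.
Proof. by rewrite dotC dotDr !(dotC w). Qed.

Lemma dotZl a u v : dot (a *: u) v = a * dot u v.
Proof. by rewrite dotC dotZr dotC. Qed.

Lemma dot0r u : dot u 0 = 0.
Proof. by rewrite /dot big1 // => i _; rewrite mxE mulr0. Qed.

Lemma dotNr u v : dot u (- v) = - dot u v.
Proof. by rewrite -scaleN1r dotZr mulN1r. Qed.

Lemma dotNl u v : dot (- u) v = - dot u v.
Proof. by rewrite dotC dotNr dotC. Qed.

Lemma dotBr u v w : dot u (v - w) = dot u v - dot u w.
Proof. by rewrite dotDr dotNr. Qed.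

Lemma dotBl u v w : dot (u - v) w = dot u w - dot v w.
Proof. by rewrite dotC dotBr !(dotC w). Qed.

Lemma dot_sumr (I : finType) (P : pred I) (F : I -> vec) u :
  dot u (\sum_(i | P i) F i) = \sum_(i | P i) dot u (F i).
Proof. by elim/big_rec2: _ => [|i a b _ <-]; rewrite ?dot0r ?dotDr. Qed.

Lemma dot_suml (I : finType) (P : pred I) (F : I -> vec) u :
  dot (\sum_(i | P i) F i) u = \sum_(i | P i) dot (F i) u.
Proof. by rewrite dotC dot_sumr; apply: eq_bigr => i _; rewrite dotC. Qed.

Lemma dot_ge0 u : 0 <= dot u u.
Proof. by apply: sumr_ge0 => i _; rewrite -expr2 sqr_ge0. Qed.

Lemma coord_sqr_le_dot u i : u i 0 ^+ 2 <= dot u u.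
Proof.
rewrite /dot (bigD1 i) //= -expr2 lerDl.
by apply: sumr_ge0 => j _; rewrite -expr2 sqr_ge0.
Qed.

Lemma dot_eq0 u : dot u u = 0 -> u = 0.
Proof.
move=> u0; apply/matrixP => i j; rewrite ord1 mxE; apply/eqP.
by rewrite -sqrf_eq0 eq_le sqr_ge0 -u0 coord_sqr_le_dot.
Qed.

Lemma dot_gt0 u : u != 0 -> 0 < dot u u.
Proof.
by move=> u0; rewrite lt0r dot_ge0 andbT; apply: contra u0 => /eqP/dot_eq0->.
Qed.

Lemma dot_continuous (F G : vec -> vec) :
  (forall i, continuous (fun x => F x i 0)) ->
  (forall i, continuous (fun x => G x i 0)) ->
  continuous (fun x => dot (F x) (G x)).
Proof.
move=> cF cG; apply: continuous_big => [|i _ x]; first exact: add_continuous.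
exact: continuousM (cF i x) (cG i x).
Qed.

End DotProduct.

(** * Maxima on compact sets *)

Section Compactness.
Context {R : realType} {n : nat}.
Local Notation vec := 'cV[R]_n.

Lemma trmx_continuous m k : continuous (@trmx R m k).
Proof.
move=> M A [P MP PA]; exists (fun i j => P j i) => [i j|N /= NP].
  by have := MP j i; rewrite mxE.
by apply: PA => i j; rewrite mxE; exact: NP.
Qed.

(** Boxes of row vectors are compact; transposition carries this over to
    column vectors. *)
Lemma closed_box_EVT_max (K : set vec) (M : R) (F : vec -> R) :
  K !=set0 -> closed K -> (forall x, K x -> forall i, `|x i 0| <= M) ->
  continuous F -> exists2 z, K z & forall x, K x -> F x <= F z.
Proof.
move=> [x0 Kx0] Kcl KM cF.
pose K' := [set w : 'rV[R]_n | K w^T].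
have cFT : continuous (fun w : 'rV[R]_n => F w^T).
  by move=> w; apply: continuous_comp; [exact: trmx_continuous|exact: cF].
have K'cl : closed K'.
  by apply: (preimage_closed (D := K) (f := @trmx R 1 n)) => // w _; exact: trmx_continuous.
have K'co : compact K'.
  apply: (subclosed_compact K'cl (@rV_compact _ n (fun=> `[- M, M]%classic) _)).
    by move=> _; exact: segment_compact.
  move=> w /KM wM i /=; rewrite in_itv /= -ler_norml.
  by have := wM i; rewrite mxE.
have [||z zK' zmax] := compact_EVT_max _ K'co (f := fun w => F w^T).
- by exists x0^T; rewrite /K' /= trmxK.
- by apply: continuous_subspaceT.
exists z^T; first by rewrite inE in zK'.
by move=> x Kx; have := zmax x^T; rewrite trmxK; apply; rewrite inE /K' /= trmxK.
Qed.

End Compactness.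

(** * Interior and boundary of a closed convex set *)

Section ConvexBody.
Context {R : realType} {n : nat}.
Local Notation vec := 'cV[R]_n.
Implicit Types (S : set vec) (o u v w x y d : vec).

(** The topology of matrices is that of the max norm, so neighbourhoods can be
    tested on boxes. *)
Lemma interiorP S x :
  S° x <-> exists2 e : R, 0 < e &
             forall w, (forall i, `|w i 0| < e) -> S (x + w).
Proof.
rewrite /interior; split => [/nbhs_ballP[e e0 xeS]|[e e0 eS]].
  exists e => // w we; apply: xeS; split => // i j; rewrite ord1 /ball /= mxE.
  by rewrite opprD addNKr normrN.
apply/nbhs_ballP; exists e => // y [_ xy].
rewrite -(subrKC x y); apply: eS => i; rewrite !mxE.
by have := xy i 0; rewrite /ball /= distrC.
Qed.

Lemma interior_subW S x : S° x -> S x.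
Proof. exact: interior_subset. Qed.

Lemma scaled_small (e : R) w : 0 < e ->
  exists2 t : R, 0 < t &
    forall s, 0 <= s <= t -> forall i, `|(s *: w) i 0| < e.
Proof.
move=> e0; pose M := 1 + \sum_i `|w i 0|.
have M0 : 0 < M by rewrite ltr_wpDr // sumr_ge0.
have eM : 0 < e / M by rewrite divr_gt0.
exists (e / M) => // s /andP[s0 st] i.
rewrite mxE normrM ger0_norm //.
apply: (le_lt_trans (y := e / M * `|w i 0|)); first by rewrite ler_wpM2r.
rewrite mulrAC ltr_pdivrMr // ltr_pM2l // /M (bigD1 i) //= addrCA ltrDl.
by rewrite ltr_wpDr // sumr_ge0.
Qed.

Lemma interior_move S x w : S° x ->
  exists2 e : R, 0 < e & forall t, 0 <= t <= e -> S° (x + t *: w).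
Proof.
move=> /interiorP[e e0 eS]; have e20 : 0 < e / 2 by rewrite divr_gt0.
have [t t0 tw] := scaled_small w e20.
exists t => // s st; apply/interiorP; exists (e / 2) => // z ze.
rewrite -addrA; apply: eS => i; rewrite mxE.
by rewrite (le_lt_trans (ler_normD _ _)) // (splitr e) ltrD // tw.
Qed.

Section Convex.
Variables (S : set vec).
Hypotheses (Scl : closed S) (Scv : convex_set S).

Lemma convex_segment x y (t : R) : S x -> S y -> 0 <= t <= 1 ->
  S (x + t *: (y - x)).
Proof.
move=> Sx Sy /andP[t0 t1].
have := Scv (Itv01 t0 t1) (mem_set Sy) (mem_set Sx).
by rewrite inE; congr S; rewrite /conv /= /unstable.onem; vec_ring.
Qed.

Lemma bdP p : bd S p <-> S p /\ ~ S° p.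
Proof. by rewrite /bd -((closure_id S).1 Scl). Qed.

(** The homothety of centre y and ratio 1 - t maps a box around x contained in
    S onto a box around the given point, again contained in S. *)
Lemma interior_segment x y (t : R) : S° x -> S y -> 0 <= t < 1 ->
  S° (x + t *: (y - x)).
Proof.
move=> /interiorP[e e0 eS] Sy /andP[t0 t1]; apply/interiorP.
have t1' : 0 < 1 - t by rewrite subr_gt0.
exists ((1 - t) * e) => [|w we]; first by rewrite mulr_gt0.
have Sxw : S (x + (1 - t)^-1 *: w).
  apply: eS => i; rewrite mxE normrM normfV (gtr0_norm t1').
  by rewrite ltr_pdivrMl.
have := convex_segment Sxw Sy (t := t); rewrite t0 (ltW t1) => /(_ isT).
by congr S; vec_field; rewrite gt_eqF.
Qed.

(** Take the last parameter at which the segment is in S. Closedness puts that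
    point in S; were it interior, the segment would stay in S a little longer. *)
Lemma segment_crosses_bd v y : S° v -> ~ S° y ->
  exists2 t : R, 0 < t <= 1 & bd S (v + t *: (y - v)).
Proof.
move=> Sv Sy; pose T := [set t : R | 0 <= t <= 1 /\ S (v + t *: (y - v))].
have T0 : T 0 by split; rewrite ?lexx ?ler01 // scale0r addr0; exact: interior_subW.
have supT : has_sup T by split; [exists 0|exists 1 => t [/andP[]]].
pose s := sup T.
have s0 : 0 <= s by apply: ub_le_sup => //; exists 1 => t [/andP[]].
have s1 : s <= 1 by apply: ge_sup; [exists 0|move=> t [/andP[]]].
have Ss : S (v + s *: (y - v)).
  apply: contrapT => nS.
  have sgt0 : 0 < s.
    rewrite lt_neqAle s0 andbT; apply/eqP => s00; apply: nS.
    by rewrite -s00 scale0r addr0; exact: interior_subW.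
  have [|e e0 Se] := @interior_move (~` S) (v + s *: (y - v)) (v - y).
    by have : open (~` S) by [rewrite openC]; rewrite openE; apply.
  pose e' := Num.min e s.
  have e'0 : 0 < e' by rewrite lt_min e0.
  have [t [t01 St] st] := sup_adherent e'0 supT; rewrite -/s in st.
  have se0 : 0 <= s - e' by rewrite subr_ge0 ge_min lexx orbT.
  have t0 : 0 < t by exact: le_lt_trans se0 st.
  have /Se/interior_subW : 0 <= e' <= e by rewrite (ltW e'0) ge_min lexx.
  apply; have := @convex_segment v _ ((s - e') / t) (interior_subW Sv) St.
  rewrite divr_ge0 ?(ltW t0) //= ler_pdivrMr // mul1r (ltW st) => /(_ isT).
  rewrite [v + t *: _]addrC addrK scalerA divfK ?gt_eqF // -addrA.
  by rewrite -[v - y]opprB scalerN -scalerBl.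
have nSs : ~ S° (v + s *: (y - v)).
  move=> Sos; have slt1 : s < 1.
    rewrite lt_neqAle s1 andbT; apply/eqP => s11; apply: Sy.
    by rewrite -(subrKC v y) -[y - v]scale1r -s11.
  have [e e0 Se] := interior_move (y - v) Sos.
  pose e' := Num.min e (1 - s).
  have e'0 : 0 < e' by rewrite lt_min e0 subr_gt0.
  suff : s + e' <= s by rewrite gerDl leNgt e'0.
  apply: ub_le_sup; first by exists 1 => t' [/andP[]].
  split; first by rewrite addr_ge0 ?(ltW e'0) //= -lerBrDl ge_min lexx orbT.
  rewrite scalerDl addrA; apply: interior_subW; apply: Se.
  by rewrite (ltW e'0) ge_min lexx.
exists s; last exact/bdP.
rewrite s1 andbT lt_neqAle s0 andbT; apply/eqP => s00; apply: nSs.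
by rewrite -s00 scale0r addr0.
Qed.

Lemma interior_before v d (s t : R) : S° v -> S (v + t *: d) ->
  0 <= s < t -> S° (v + s *: d).
Proof.
move=> Sv St /andP[s0 st]; have t0 := le_lt_trans s0 st.
have := @interior_segment v _ (s / t) Sv St.
rewrite divr_ge0 ?(ltW t0) //= ltr_pdivrMr // mul1r st => /(_ isT).
by rewrite [v + t *: _]addrC addrK scalerA divfK ?gt_eqF.
Qed.

Lemma bd_ray_uniq v d (s t : R) : S° v -> 0 <= s -> 0 <= t ->
  bd S (v + s *: d) -> bd S (v + t *: d) -> s = t.
Proof.
move=> Sv s0 t0 /bdP[Ss nSs] /bdP[St nSt].
have [st|ts|//] := ltgtP s t.
  by case: nSs; apply: (interior_before Sv St); rewrite s0.
by case: nSt; apply: (interior_before Sv Ss); rewrite t0.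
Qed.

Lemma ray_crosses_bd v d (t : R) : S° v -> 0 <= t -> ~ S° (v + t *: d) ->
  exists2 s : R, 0 < s <= t & bd S (v + s *: d).
Proof.
move=> Sv t0 nSt; have [s /andP[s0 s1] sbd] := segment_crosses_bd Sv nSt.
have tgt0 : 0 < t.
  rewrite lt_neqAle t0 andbT; apply/eqP => t00; apply: nSt.
  by rewrite -t00 scale0r addr0.
exists (s * t); last by move: sbd; rewrite [v + t *: _]addrC addrK scalerA.
by rewrite mulr_gt0 //= ler_piMl.
Qed.

(** Quantified over all starting points in S: a direction is found on one
    half-line and used from other points. *)
Definition recession d := forall z (t : R), S z -> 0 <= t -> S (z + t *: d).

(** If z + t d were outside S, so would be z + t d + e (v - z) for a small
    positive e; but this is the point at parameter e of the segment from z to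
    the point v + (t / e) d of the half-line. *)
Lemma recession_of_halfline v d : S v ->
  (forall t, 0 <= t -> S (v + t *: d)) -> recession d.
Proof.
move=> Sv Svd z t Sz t0; apply: contrapT => nS.
have [|e e0 Se] := @interior_move (~` S) (z + t *: d) (v - z).
  by have : open (~` S) by [rewrite openC]; rewrite openE; apply.
pose e' := Num.min e 1.
have e'0 : 0 < e' by rewrite lt_min e0 ltr01.
have /Se/interior_subW : 0 <= e' <= e by rewrite (ltW e'0) ge_min lexx.
apply; have Sd := Svd (t / e') (divr_ge0 t0 (ltW e'0)).
have := convex_segment (t := e') Sz Sd.
rewrite (ltW e'0) ge_min lexx orbT => /(_ isT).
by congr S; vec_field; rewrite gt_eqF.
Qed.

Lemma recession_ray v d : S° v -> (forall t, 0 <= t -> ~ bd S (v + t *: d)) ->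
  recession d.
Proof.
move=> Sv nbd; apply: (recession_of_halfline (interior_subW Sv)) => t t0.
apply: contrapT => nS.
have [|s /andP[s0 _]] := ray_crosses_bd (d := d) Sv t0; last exact/nbd/ltW.
by move/interior_subW.
Qed.

Lemma recession_interior d z (t : R) : recession d -> S° z -> 0 <= t ->
  S° (z + t *: d).
Proof.
move=> rd /interiorP[e e0 eS] t0; apply/interiorP; exists e => // w we.
by rewrite addrAC; apply: rd => //; exact: eS.
Qed.

(** Seen from o, the point is a convex combination of the two given points
    scaled by a + b, and a + b is less than 1. *)
Lemma star_interior o w1 w2 (a b : R) : S° o -> S (o + w1) -> S (o + w2) ->
  0 <= a -> 0 <= b -> a + b < 1 -> S° (o + (a *: w1 + b *: w2)).
Proof.
move=> So S1 S2 a0 b0 ab1; have [ab0|abn0] := eqVneq (a + b) 0.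
  have /eqP : a == 0 by rewrite eq_le a0 -ab0 lerDl b0.
  move=> a00; rewrite a00 add0r in ab0.
  by rewrite a00 ab0 !scale0r !addr0.
have abgt0 : 0 < a + b by rewrite lt0r abn0 addr_ge0.
have Sm : S (o + (a + b)^-1 *: (a *: w1 + b *: w2)).
  have b01 : 0 <= b / (a + b) <= 1.
    by rewrite divr_ge0 ?(ltW abgt0) //= ler_pdivrMr // mul1r lerDr.
  have := convex_segment (t := b / (a + b)) S1 S2 b01.
  by congr S; vec_field.
have := @interior_before o ((a + b)^-1 *: (a *: w1 + b *: w2)) (a + b) 1 So.
rewrite scale1r => /(_ Sm); rewrite (ltW abgt0) => /(_ ab1).
by rewrite scalerA mulfV // scale1r.
Qed.

End Convex.
End ConvexBody.

(** * Supporting functionals *)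

Section Support.
Context {R : realType} {n : nat}.
Local Notation vec := 'cV[R]_n.
Implicit Types (o u v w x y d : vec).
Variables (S : set vec).
Hypotheses (Scl : closed S) (Scv : convex_set S).

Lemma closed_sublevel (F : vec -> R) (a : R) :
  continuous F -> closed [set x | F x <= a].
Proof. by move=> cF; apply: (preimage_closed (D := [set r | r <= a])). Qed.

Lemma entry_continuous i : continuous (fun x : vec => x i 0).
Proof. exact: coord_continuous. Qed.

(** The point z is the Euclidean projection of x on S, and s = x - z: if s
    were larger at some y of S than at z, moving from z towards y would
    decrease the distance to x. *)
Lemma separation x y0 : S y0 -> ~ S x ->
  exists s, exists2 z, S z &
    dot s z < dot s x /\ forall y, S y -> dot s y <= dot s z.
Proof.
move=> Sy0 nSx; pose q (y : vec) := dot (y - x) (y - x).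
have cq : continuous q.
  have cqi i : continuous (fun y : vec => (y - x) i 0).
    have -> : (fun y : vec => (y - x) i 0) = (fun y => y i 0) - cst (x i 0).
      by apply/funext => y; rewrite !mxE.
    by move=> y; apply: continuousB; [exact: entry_continuous|exact: cst_continuous].
  exact: dot_continuous.
pose K := S `&` [set y | q y <= q y0].
(* an entry a of y - x satisfies |a| <= a ^ 2 + 1 <= q y + 1 *)
have [||||z [Sz qz] zmin] :=
    @closed_box_EVT_max _ _ K (\sum_i `|x i 0| + (q y0 + 1)) (fun y => - q y).
- by exists y0; split => //=.
- by apply: closedI => //; exact: closed_sublevel.
- move=> y Ky i; have yx : `|(y - x) i 0| <= q y0 + 1.
    have [y1|y1] := leP `|(y - x) i 0| 1.
      by rewrite (le_trans y1) // lerDr dot_ge0.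
    rewrite (@le_trans _ _ (q y)) //; last by rewrite (le_trans Ky.2) // lerDl.
    apply: le_trans (coord_sqr_le_dot _ i).
    by rewrite -real_normK ?num_real // expr2 ler_peMl // ltW.
  rewrite -(subrKC x y) mxE (le_trans (ler_normD _ _)) // lerD //.
  by rewrite (bigD1 i) //= lerDl sumr_ge0.
- by move=> y; apply: continuousN; exact: cq.
exists (x - z), z => //; split.
  rewrite -subr_gt0 -dotBr; apply: dot_gt0; rewrite subr_eq0.
  by apply/eqP => xz; apply: nSx; rewrite xz.
move=> y Sy; rewrite -subr_ge0 -dotBr leNgt; apply/negP => lt0.
have dyz : 0 < dot (y - z) (y - z).
  apply: dot_gt0; rewrite subr_eq0; apply/eqP => yz.
  by move: lt0; rewrite yz subrr dot0r ltxx.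
set p := dot (x - z) (z - y) in lt0; set D := dot (y - z) (y - z) in dyz.
have qE t : q (z + t *: (y - z)) = q z + t * (2 * p) + t ^+ 2 * D.
  have expand P Q : dot (- P + t *: Q) (- P + t *: Q) =
      dot P P + t * (2 * - dot P Q) + t ^+ 2 * dot Q Q.
    rewrite !(dotDl, dotDr, dotZl, dotZr, dotNr, dotNl) (dotC Q P); ring.
  rewrite /p /D -[z - y]opprB dotNr /q -[z - x]opprB dotNr dotNl opprK -expand.
  by congr dot; vec_ring.
(* - p / D minimises the quadratic of qE *)
pose t := Num.min 1 (- p / D).
have t0 : 0 < t by rewrite lt_min ltr01 divr_gt0 // oppr_gt0.
have Szt : S (z + t *: (y - z)).
  by apply: convex_segment => //; rewrite (ltW t0) ge_min lexx.
have : q (z + t *: (y - z)) < q z.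
  rewrite qE -addrA gtrDl expr2 -mulrA -mulrDr pmulr_rlt0 //.
  have : t * D <= - p by rewrite -ler_pdivlMr // ge_min lexx orbT.
  lra.
move=> qlt; suff /zmin : K (z + t *: (y - z)) by rewrite lerN2 leNgt qlt.
by split => //=; rewrite (le_trans (ltW qlt)).
Qed.

(** The polar of S about o is compact since S contains a box around o; s is
    chosen in it to maximise the value at x. If the maximum were less than 1,
    a point slightly beyond x, outside S, would have value less than 1 as
    well; a functional separating it from S, normalised to belong to the
    polar, would then exceed the maximum. Maximising over the polar is what
    makes the bound 1 attained when x lies on the boundary of S. *)
Lemma supporting_functional o x : S° o -> ~ S° x ->
  exists s, (forall y, S y -> dot s (y - o) <= 1) /\ 1 <= dot s (x - o).
Proof.
move=> So nSx.
have [e e0 eS] := (interiorP S o).1 So.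
pose K := \bigcap_(y in S) [set s : vec | dot s (y - o) <= 1].
have cdot (w : vec) : continuous (fun s : vec => dot s w).
  apply: (@dot_continuous _ _ id (fun=> w)) => i; last exact: cst_continuous.
  exact: entry_continuous.
have K0 : K 0 by move=> y _ /=; rewrite dotC dot0r.
have [||||s Ks smax] :=
    @closed_box_EVT_max _ _ K (2 / e) (fun s => dot s (x - o)).
- by exists 0.
- by apply: closed_bigI => y _; apply: closed_sublevel.
- move=> s Ks i.
  have bound (a : R) : `|a| < e -> a * s i 0 <= 1.
    move=> ae; have Sa : S (o + a *: delta_mx i 0).
      by apply: eS => j; rewrite !mxE; case: eqP => _; rewrite ?mulr1 ?mulr0 ?normr0.
    have := Ks _ Sa; rewrite /= (addrC o) addrK dotZr /dot.
    rewrite (bigD1 i) //= big1 ?addr0 ?mxE ?eqxx ?mulr1 // => j ji.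
    by rewrite mxE (negPf ji) mulr0.
  have e2 : `|e / 2| < e by rewrite gtr0_norm ?divr_gt0 // ltr_pdivrMr //; lra.
  have := bound _ e2; have := bound (- (e / 2)); rewrite normrN => /(_ e2).
  by move=> b1 b2; rewrite ler_norml lerNl !ler_pdivlMr //; apply/andP; split; lra.
- exact: cdot.
exists s; split; first exact: Ks.
apply: contrapT => /negP; rewrite -ltNge => s1.
(* the point slightly beyond x is outside S *)
have [t t1 tlt] : exists2 t : R, 1 < t & t * dot s (x - o) < 1.
  have [s0|s0] := leP (dot s (x - o)) 0.
    by exists 2; [lra|rewrite (@le_lt_trans _ _ 0) // pmulr_rle0].
  exists (2 / (1 + dot s (x - o))).
    by rewrite ltr_pdivlMr ?mul1r; lra.
  by rewrite mulrAC ltr_pdivrMr ?mul1r; lra.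
have t0 : 0 < t by exact: lt_trans t1.
have nSt : ~ S (o + t *: (x - o)).
  move=> St; apply: nSx.
  have := @interior_before _ _ _ Scv o (x - o) 1 t So St.
  by rewrite ler01 t1 scale1r subrKC; exact.
have [r [z Sz [rzx rmax]]] := separation (interior_subW So) nSt.
pose m := dot r (z - o).
have m0 : 0 < m.
  have r0 : r != 0 by apply: contraTneq rzx => ->; rewrite !(dotC 0) !dot0r ltxx.
  have [a a0 Sa] := interior_move r So.
  have /Sa/interior_subW/rmax : 0 <= a <= a by rewrite ltW /=.
  rewrite dotDr dotZr -lerBrDl -dotBr -/m; apply: lt_le_trans.
  by rewrite mulr_gt0 // dot_gt0.
have Kr : K (m^-1 *: r).
  move=> y Sy /=; rewrite dotZl ler_pdivrMl // mulr1 /m !dotBr lerD2r.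
  exact: rmax.
have := smax _ Kr; rewrite leNgt => /negP; apply.
rewrite dotZl ltr_pdivlMl // -(ltr_pM2l t0).
have : m < t * dot r (x - o).
  by rewrite /m -dotZr dotBr ltrBlDl -dotDr.
by apply: le_lt_trans; rewrite mulrCA ler_piMr ?(ltW m0) ?(ltW tlt).
Qed.

Section Polar.
Variables (o s : vec).
Hypothesis sS : forall y, S y -> dot s (y - o) <= 1.

Lemma polar_le1 w : S (o + w) -> dot s w <= 1.
Proof. by move/sS; rewrite (addrC o) addrK. Qed.

Lemma polar_interior w : S° (o + w) -> dot s w < 1.
Proof.
move=> Sw; rewrite ltNge; apply/negP => s1.
have [e e0 Se] := interior_move w Sw.
have /Se/interior_subW : 0 <= e <= e by rewrite ltW /=.
rewrite -addrA => /polar_le1; rewrite dotDr dotZr leNgt => /negP; apply.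
by rewrite (le_lt_trans s1) // ltrDl mulr_gt0 // (lt_le_trans _ s1).
Qed.

Lemma polar_recession d : S o -> recession S d -> dot s d <= 0.
Proof.
move=> So rd; rewrite leNgt; apply/negP => s0.
have t0 : 0 <= 2 / dot s d by rewrite divr_ge0 // ltW.
have := polar_le1 (rd _ _ So t0); rewrite dotZr divfK ?gt_eqF //; lra.
Qed.
End Polar.

End Support.

(** * Directions of edges *)

Section Edges.
Context {R : realType} {n : nat}.
Local Notation vec := 'cV[R]_n.
Implicit Types (Q : set vec) (v d : vec).

(** The functional that exposes the edge is nonnegative on each w i and
    vanishes on d, hence on every w i that occurs in d. So the half-line from
    v along w l lies, near v, on the edge. *)
Lemma edge_generator (I : finType) Q v d (w : I -> vec) (c : I -> R) l :
  edge_from Q v d -> (forall i, 0 <= c i) -> d = \sum_i c i *: w i ->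
  (forall i, exists2 e : R, 0 < e & Q (v + e *: w i)) ->
  w l != 0 -> 0 < c l -> exists2 mu : R, 0 < mu & d = mu *: w l.
Proof.
move=> [d1 [F [QF edgeE]] Qv [t t0 Qt]] c0 dE Qw wl0 cl0.
have in_edge x : edge Q v d x -> dot (normal F) x = offset F.
  by rewrite edgeE => -[].
have Fv : dot (normal F) v = offset F.
  by apply: in_edge; split => //; exists 0; rewrite ?scale0r ?addr0.
have Fd : dot (normal F) d = 0.
  have /in_edge : edge Q v d (v + t *: d) by split => //; exists t => //; rewrite ltW.
  rewrite dotDr dotZr Fv -[RHS]addr0 => /addrI/eqP.
  by rewrite mulf_eq0 gt_eqF //= => /eqP.
have Fw i : 0 <= dot (normal F) (w i).
  have [e e0 /QF] := Qw i; rewrite /hspace /= dotDr dotZr Fv lerDl.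
  by rewrite pmulr_rge0.
have Fwl : dot (normal F) (w l) = 0.
  apply/eqP; move/eqP: Fd; rewrite dE dot_sumr psumr_eq0 => [|i _]; last first.
    by rewrite dotZr mulr_ge0.
  move=> /allP/(_ l); rewrite mem_index_enum => /(_ isT) /=.
  by rewrite dotZr mulf_eq0 gt_eqF.
have [e e0 Qe] := Qw l.
have [_ [s s0 /addrI es]] : edge Q v d (v + e *: w l).
  by rewrite edgeE; split => //; rewrite /hset /= dotDr dotZr Fwl mulr0 addr0.
have sn0 : s != 0.
  apply: contra wl0 => /eqP s00; move: es; rewrite s00 scale0r => /eqP.
  by rewrite scaler_eq0 gt_eqF.
exists (s^-1 * e); first by rewrite mulr_gt0 // invr_gt0 lt0r sn0.
by rewrite -scalerA es scalerA mulVf // scale1r.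
Qed.

Lemma unit_scale_inj (a b : R) v : 0 < a -> 0 < b ->
  dot (a *: v) (a *: v) = 1 -> dot (b *: v) (b *: v) = 1 -> a = b.
Proof.
move=> a0 b0; rewrite !(dotZl, dotZr) => a1 b1; apply/eqP.
have v0 : dot v v != 0.
  by apply: contra_eq_neq a1 => ->; rewrite !mulr0 eq_sym oner_neq0.
rewrite -(eqrXn2 (n := 2)) ?(ltW a0) ?(ltW b0) // !expr2.
by apply/eqP/(mulIf v0); rewrite -!mulrA a1 b1.
Qed.

End Edges.

(** * Coordinates of the basis cone *)

Section SimplicialCone.
Context {R : realType} {n : nat}.
Local Notation vec := 'cV[R]_n.
Variables (Hbar : 'I_n -> hyperplane R n) (o : vec).
Let N : 'M[R]_n := \matrix_(i, j) normal (Hbar i) j 0.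
Hypotheses (Nunit : N \in unitmx) (ho : forall i, hset (Hbar i) o).
Implicit Types (w r d : vec) (i j l : 'I_n).

Let gen j : vec := col j (invmx N).
Let len j : R := Num.sqrt (dot (gen j) (gen j)).

(** The edges of the cone are spanned by the columns of the inverse of the
    matrix of facet normals. The definition is locked because it is a scaling,
    which rewriting with the laws of scalings would unfold. *)
Definition ray j : vec := locked
  ((Num.sqrt (dot (col j (invmx N)) (col j (invmx N))))^-1 *: col j (invmx N)).

(** The dual basis of the rays, that is, the facet normals rescaled. *)
Definition dual j : vec := locked
  (Num.sqrt (dot (col j (invmx N)) (col j (invmx N))) *: normal (Hbar j)).

Lemma rayE j : ray j = (len j)^-1 *: gen j.
Proof. by rewrite /ray -lock. Qed.

Lemma dualE j : dual j = len j *: normal (Hbar j).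
Proof. by rewrite /dual -lock. Qed.

Lemma normal_gen i j : dot (normal (Hbar i)) (gen j) = (i == j)%:R.
Proof.
have := congr1 (fun M : 'M[R]_n => M i j) (mulmxV Nunit).
by rewrite !mxE => <-; apply: eq_bigr => k _; rewrite !mxE.
Qed.

Lemma len_gt0 j : 0 < len j.
Proof.
rewrite sqrtr_gt0; apply: dot_gt0; apply: contra_eq_neq (normal_gen j j) => ->.
by rewrite dot0r eqxx eq_sym oner_neq0.
Qed.

Lemma dual_ray i j : dot (dual i) (ray j) = (i == j)%:R.
Proof.
rewrite rayE dualE dotZl dotZr normal_gen; have [->|_] := eqVneq i j; last by rewrite !mulr0.
by rewrite mulr1 mulfV // gt_eqF // len_gt0.
Qed.

Lemma ray_unit j : dot (ray j) (ray j) = 1.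
Proof.
rewrite rayE dotZl dotZr mulrA -expr2 exprVn sqr_sqrtr ?dot_ge0 //.
by rewrite mulVf // gt_eqF // -sqrtr_gt0 len_gt0.
Qed.

Lemma coord_decomp w : w = \sum_j dot (dual j) w *: ray j.
Proof.
have NE : N *m w = \col_j dot (normal (Hbar j)) w.
  by apply/matrixP => i k; rewrite !mxE ord1; apply: eq_bigr => ? _; rewrite !mxE.
rewrite -{1}[w](mulKmx Nunit) NE; apply/matrixP => i k; rewrite ord1 mxE summxE.
apply: eq_bigr => j _; rewrite rayE dualE !mxE dotZl mulrACA mulfV ?gt_eqF ?len_gt0 //.
by rewrite mul1r mulrC.
Qed.

Lemma dot_decomp u w : dot u w = \sum_j dot (dual j) w * dot u (ray j).
Proof.
by rewrite [in LHS](coord_decomp w) dot_sumr; apply: eq_bigr => j _; rewrite dotZr.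
Qed.

Lemma hset_dual i w : hset (Hbar i) (o + w) <-> dot (dual i) w = 0.
Proof.
rewrite /hset /= dotDr (ho i) dualE dotZl; split => [|/eqP].
  by rewrite -[RHS]addr0 => /addrI ->; rewrite mulr0.
by rewrite mulf_eq0 gt_eqF ?len_gt0 //= => /eqP ->; rewrite addr0.
Qed.

Lemma basis_coneP w : basis_cone Hbar (o + w) <-> forall j, 0 <= dot (dual j) w.
Proof.
have E j : hspace (Hbar j) (o + w) = (0 <= dot (dual j) w) :> Prop.
  by rewrite /hspace /= dotDr (ho j) lerDl dualE dotZl pmulr_rge0 // len_gt0.
by split => h j; have := h j; rewrite E.
Qed.

Lemma cone_apex : basis_cone Hbar o.
Proof. by move=> i; rewrite /hspace /= (ho i). Qed.

Lemma ray_neq0 j : ray j != 0.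
Proof. by apply: contra_eq_neq (ray_unit j) => ->; rewrite dot0r eq_sym oner_neq0. Qed.

Lemma dual2 l i j (s t : R) : dot (dual l) (s *: ray i + t *: ray j) =
  s * (l == i)%:R + t * (l == j)%:R.
Proof. by rewrite dotDr !dotZr !dual_ray. Qed.

(** The coordinates of an edge direction are nonnegative, so edge_generator
    makes it proportional to a ray. Conversely, a ray is exposed by the sum of
    the other coordinates. *)
Lemma RbarP r : Rbar Hbar o r <-> exists j, r = ray j.
Proof.
split=> [er|[j ->]].
  have [r1 _ _ [t t0 Qt]] := er.
  have c0 j : 0 <= dot (dual j) r.
    by have /basis_coneP/(_ j) := Qt; rewrite dotZr pmulr_rge0.
  have [j cj] : exists j, 0 < dot (dual j) r.
    apply: contrapT => /forallNP nc; move: r1.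
    rewrite (coord_decomp r) big1 ?dot0r => [/eqP|j _].
      by rewrite eq_sym oner_eq0.
    have /negP := nc j; rewrite -leNgt => cj.
    suff -> : dot (dual j) r = 0 by rewrite scale0r.
    by apply/eqP; rewrite eq_le cj c0.
  have [i|mu mu0 rE] := edge_generator er c0 (coord_decomp r) _ (ray_neq0 j) cj.
    exists 1; rewrite ?ltr01 //; apply/basis_coneP => l /=.
    by rewrite scale1r dual_ray ler0n.
  exists j; rewrite rE; suff -> : mu = 1 by rewrite scale1r.
  apply: (unit_scale_inj (v := ray j)) => //; first by rewrite -rE.
  by rewrite scale1r ray_unit.
split; first exact: ray_unit.
- exists (Hyperplane (\sum_(l | l != j) dual l) (dot (\sum_(l | l != j) dual l) o)).
  split => [x|]; first rewrite -(subrKC o x) => /basis_coneP xo.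
    rewrite /hspace /= dotDr lerDl dot_suml; exact: sumr_ge0.
  apply/seteqP; split => x [Qx xE]; split => //.
    have [s s0 ->] := xE; rewrite /hset /= dotDr -[RHS]addr0; congr (_ + _).
    rewrite dot_suml; apply: big1 => l lj.
    by rewrite dotZr dual_ray (negPf lj) mulr0.
  move: xE Qx; rewrite -(subrKC o x); set w := x - o.
  rewrite /hset /= dotDr -[RHS]addr0 => /addrI/eqP + /basis_coneP wo.
  rewrite dot_suml psumr_eq0 // => /allP w0.
  exists (dot (dual j) w); rewrite ?wo //; congr (_ + _).
  rewrite {1}(coord_decomp w) (bigD1 j) //= big1 ?addr0 // => l lj.
  have := w0 l; rewrite mem_index_enum lj => /(_ isT)/eqP ->.
  by rewrite scale0r.
- exact: cone_apex.
- exists 1; rewrite ?ltr01 //; apply/basis_coneP => l.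
  by rewrite scale1r dual_ray ler0n.
Qed.

End SimplicialCone.

(** * Hyperplanes that leave the apex strictly on one side *)

Section CutHyperplane.
Context {R : realType} {n : nat}.
Local Notation vec := 'cV[R]_n.
Variables (o : vec) (S : set vec) (H : hyperplane R n).
Implicit Types (w d : vec) (t : R).

(** The equation of H in normalised form: with o as the origin, H is the level
    set 1 of this linear functional, and the side of H that contains o is
    where it is at most 1. Its value on a ray that meets H is the inverse of
    the distance to H along the ray. *)
Definition cutfun : vec :=
  locked ((offset H - dot (normal H) o)^-1 *: normal H).
Local Notation eta := cutfun.

Section Normalised.
Hypothesis Ho : offset H < dot (normal H) o.
Let gap := offset H - dot (normal H) o.

Lemma gap_lt0 : gap < 0. Proof. by rewrite subr_lt0. Qed.

Lemma dot_normal w : dot (normal H) w = gap * dot eta w.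
Proof. by rewrite /eta -lock dotZl mulVKf // lt_eqF // gap_lt0. Qed.

Lemma hspace_cutfun w : hspace H (o + w) <-> dot eta w <= 1.
Proof.
rewrite /hspace /= dotDr (dot_normal w) -lerBlDl -/gap.
by rewrite -{1}[gap]mulr1 ler_nM2l // gap_lt0.
Qed.

Lemma hset_cutfun w : hset H (o + w) <-> dot eta w = 1.
Proof.
rewrite /hset /= dotDr (dot_normal w); split => [/eqP|->].
  rewrite eq_sym addrC -subr_eq eq_sym -/gap -{2}[gap]mulr1 => /eqP/mulfI->//.
  by rewrite lt_eqF // gap_lt0.
by rewrite mulr1 subrKC.
Qed.

Lemma violates_cutfun w : (dot (normal H) (o + w) < offset H) = (1 < dot eta w).
Proof.
by rewrite dotDr (dot_normal w) -ltrBrDl -/gap -{2}[gap]mulr1 ltr_nM2l // gap_lt0.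
Qed.

Lemma dir_violates_cutfun d : (dot (normal H) d < 0) = (0 < dot eta d).
Proof. by rewrite (dot_normal d) nmulr_rlt0 // gap_lt0. Qed.

Lemma dist_hyp_cutfun d : dist_hyp o H d =
  if 0 < dot eta d then ((dot eta d)^-1)%:E else +oo%E.
Proof.
rewrite /dist_hyp dir_violates_cutfun; case: ifP => // _; congr (_%:E).
by rewrite (dot_normal d) invfM mulVKf // lt_eqF // gap_lt0.
Qed.

End Normalised.

Hypotheses (Scl : closed S) (Scv : convex_set S) (So : S° o).

(** A half-line from an interior point meets the boundary at most once, so the
    infimum runs over a singleton. *)
Lemma dist_bd_fin d t : 0 <= t -> bd S (o + t *: d) -> dist_bd o S d = t%:E.
Proof.
move=> t0 bt; rewrite /dist_bd (_ : [set t | _] = [set t]) ?image_set1 ?ereal_inf1 //.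
apply/seteqP; split => [s /= [s0 bs]|_ ->] //=.
exact: (bd_ray_uniq Scl Scv So _ _ bs bt).
Qed.

Lemma dist_bd_infty d : (forall t, 0 <= t -> ~ bd S (o + t *: d)) ->
  dist_bd o S d = +oo%E.
Proof.
move=> nb; rewrite /dist_bd (_ : [set t | _] = set0) ?image_set0 ?ereal_inf0 //.
by apply/seteqP; split => // s [s0 bs]; exact: (nb s).
Qed.

Lemma cut_before_dir d : cut_before o S H d -> dot (normal H) d < 0.
Proof.
by rewrite /cut_before /dist_hyp; case: ifP => // _; rewrite ltNge leey.
Qed.

Lemma cut_before_interior d : offset H < dot (normal H) o ->
  cut_before o S H d -> S° (o + (dot eta d)^-1 *: d).
Proof.
move=> Ho cut; have := cut_before_dir cut; rewrite dir_violates_cutfun // => d0.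
move: cut; rewrite /cut_before dist_hyp_cutfun // d0 => lt_bd.
apply: contrapT => nS.
have [|s /andP[s0 st] bs] := ray_crosses_bd Scl Scv So _ nS.
  by rewrite invr_ge0 ltW.
by move: lt_bd; rewrite (dist_bd_fin (ltW s0) bs) lte_fin ltNge st.
Qed.

Lemma interior_cut_before d : offset H < dot (normal H) o -> 0 < dot eta d ->
  S° (o + (dot eta d)^-1 *: d) -> cut_before o S H d.
Proof.
move=> Ho d0 Sd; rewrite /cut_before dist_hyp_cutfun // d0.
have [[t t0 bt]|nb] := pselect (exists2 t, 0 <= t & bd S (o + t *: d)).
  rewrite (dist_bd_fin t0 bt) lte_fin ltNge; apply/negP => td.
  have /(bdP Scl)[_] := bt; apply; move: td; rewrite le_eqVlt => /predU1P[->//|td].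
  by apply: (interior_before Scv So (interior_subset Sd)); rewrite t0.
by rewrite dist_bd_infty ?ltry // => t t0 bt; apply: nb; exists t.
Qed.

(** A ray that is not cut reaches the boundary of S no later than H. Hence the
    initial point of a ray is removed only by activations that cut this ray. *)
Lemma uncut_bd_point d t : offset H <= dot (normal H) o ->
  ~~ cut_before o S H d -> 0 <= t -> bd S (o + t *: d) ->
  offset H <= dot (normal H) (o + t *: d).
Proof.
move=> Ho + t0 bt; rewrite /cut_before -leNgt (dist_bd_fin t0 bt) dotDr dotZr.
rewrite /dist_hyp; case: ifP => [d0|/negbT]; last first.
  by rewrite -leNgt => d0 _; rewrite (le_trans Ho) // lerDl mulr_ge0.
by rewrite lee_fin ler_ndivlMr // -lerBlDl.
Qed.

Lemma uncut_bd_ray d : ~~ cut_before o S H d ->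
  (forall t, 0 <= t -> ~ bd S (o + t *: d)) -> 0 <= dot (normal H) d.
Proof.
move=> + nb; rewrite /cut_before dist_bd_infty // /dist_hyp.
by case: ifP => [|/negbT]; rewrite -?leNgt // ltry.
Qed.

End CutHyperplane.

(** * Edges of the cut cone at a cut vertex *)

Section NewEdges.
Context {R : realType} {n : nat}.
Local Notation vec := 'cV[R]_n.
Variables (Hbar : 'I_n -> hyperplane R n) (o : vec) (S : set vec).
Hypothesis Nunit : \matrix_(i, j) normal (Hbar i) j 0 \in unitmx.
Hypothesis ho : forall i, hset (Hbar i) o.
Hypotheses (Scl : closed S) (Scv : convex_set S) (So : S° o).
Variable H : hyperplane R n.
Hypothesis Ho : offset H < dot (normal H) o.
Local Notation ray := (ray Hbar).
Local Notation dual := (dual Hbar).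
Local Notation eta := (cutfun o H).
Local Notation Q := (basis_cone Hbar `&` hspace H).
Implicit Types (w d v p : vec) (i j l : 'I_n).

Definition cut_vertex i : vec := o + (dot eta (ray i))^-1 *: ray i.
(** The direction from ray i to ray j inside H: the combination of both rays
    on which cutfun vanishes. *)
Definition cut_dir i j : vec :=
  locked (ray j - (dot eta (ray j) / dot eta (ray i)) *: ray i).

Lemma cut_dirE i j :
  cut_dir i j = ray j - (dot eta (ray j) / dot eta (ray i)) *: ray i.
Proof. by rewrite /cut_dir -lock. Qed.

Section AtVertex.
Variable i : 'I_n.
Hypothesis etai : 0 < dot eta (ray i).
Let etai0 : dot eta (ray i) != 0. Proof. by rewrite gt_eqF. Qed.

Lemma cut_dir_eta j : dot eta (cut_dir i j) = 0.
Proof. by rewrite cut_dirE dotBr dotZr divfK // subrr. Qed.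

Lemma cut_dir_neq0 j : j != i -> cut_dir i j != 0.
Proof.
move=> ji; apply/eqP => w0; have := congr1 (dot (dual j)) w0.
rewrite cut_dirE dotBr dotZr !dual_ray // eqxx (negPf ji) mulr0 subr0 dot0r.
by move/eqP; rewrite oner_eq0.
Qed.

Lemma cut_lineE j (t : R) : cut_vertex i + t *: cut_dir i j =
  o + (((1 - t * dot eta (ray j)) / dot eta (ray i)) *: ray i + t *: ray j).
Proof. by rewrite cut_dirE /cut_vertex; vec_field. Qed.

(** On the plane of rays i and j, only the facets j and i matter; the edge
    starts on the first and reaches the second where ray j meets H, at
    parameter 1 / eta (ray j), if ray j does meet H. *)
Lemma cut_line_in j (t : R) : j != i ->
  Q (cut_vertex i + t *: cut_dir i j) <-> 0 <= t /\ t * dot eta (ray j) <= 1.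
Proof.
move=> ji; rewrite cut_lineE; split => [[/(basis_coneP Nunit ho) c _]|[t0 t1]].
  have := c i; have := c j; rewrite !dual2 // !eqxx (negPf ji) eq_sym (negPf ji).
  by rewrite !mulr0 !mulr1 add0r addr0 => ->; rewrite ler_pdivlMr // mul0r subr_ge0.
split; last first.
  apply/hspace_cutfun => //; rewrite dotDr !dotZr divfK //.
  by rewrite subrK.
apply/(basis_coneP Nunit ho) => l; rewrite dual2 //.
by rewrite addr_ge0 // mulr_ge0 ?ler0n // divr_ge0 ?(ltW etai) // subr_ge0.
Qed.

Lemma cut_vertex_in : Q (cut_vertex i).
Proof.
split.
  apply/(basis_coneP Nunit ho) => l; rewrite dotZr dual_ray //.
  by rewrite mulr_ge0 ?ler0n // invr_ge0 ltW.
by apply/hspace_cutfun => //; rewrite dotZr mulVf.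
Qed.

(** Near the vertex, the cut cone restricted to H is generated by the
    directions cut_dir i j; the coordinates of d other than the i-th are its
    nonnegative coefficients on them. *)
Lemma new_edge_cut_dir v d : new_edge Hbar o H (ray i) (v, d) ->
  v = cut_vertex i /\
  exists2 j, j != i & exists2 mu : R, 0 < mu & d = mu *: cut_dir i j.
Proof.
move=> [/= [t t0 vE] vH ed edH].
have {t t0} vE : v = cut_vertex i.
  move: vH; rewrite vE => /hset_cutfun-/(_ Ho); rewrite dotZr => te.
  by rewrite /cut_vertex -[t](mulfK etai0) te mul1r.
split=> //; have [d1 _ Qv [t t0 Qt]] := ed.
have etad : dot eta d = 0.
  have /edH : edge Q v d (v + t *: d) by split => //; exists t => //; rewrite ltW.
  rewrite vE /cut_vertex -addrA => /hset_cutfun-/(_ Ho).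
  rewrite dotDr !dotZr mulVf // -[RHS]addr0 => /addrI/eqP.
  by rewrite mulf_eq0 gt_eqF //= => /eqP.
have dE : d = \sum_j dot (dual j) d *: cut_dir i j.
  under eq_bigr do rewrite cut_dirE scalerBr scalerA mulrA.
  rewrite big_split /= -(coord_decomp Nunit) sumrN -scaler_suml -mulr_suml.
  by rewrite -(dot_decomp Nunit) etad mul0r scale0r subr0.
have c0 j : j != i -> 0 <= dot (dual j) d.
  move=> ji; have [/= + _] := Qt; rewrite vE /cut_vertex -addrA.
  move=> /(basis_coneP Nunit ho)/(_ j); rewrite dotDr !dotZr dual_ray //.
  by rewrite (negPf ji) mulr0 add0r pmulr_rge0.
have wii : cut_dir i i = 0 by rewrite cut_dirE divff // scale1r subrr.
pose c j := if j == i then 0 else dot (dual j) d.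
have cE : d = \sum_j c j *: cut_dir i j.
  rewrite [LHS]dE; apply: eq_bigr => j _; rewrite /c; case: eqP => // ->.
  by rewrite wii !scaler0.
have cge0 j : 0 <= c j by rewrite /c; case: eqP => // /eqP /c0.
have [j cj] : exists j, 0 < c j.
  apply: contrapT => /forallNP nc; move: d1; rewrite cE big1 ?dot0r => [/eqP|j _].
    by rewrite eq_sym oner_eq0.
  have /negP := nc j; rewrite -leNgt => cj.
  suff -> : c j = 0 by rewrite scale0r.
  by apply/eqP; rewrite eq_le cj cge0.
have ji : j != i by move: cj; rewrite /c; case: eqP; rewrite ?ltxx.
exists j => //.
apply: (edge_generator ed cge0 cE _ (cut_dir_neq0 ji) cj) => l.
have [->|li] := eqVneq l i; first by exists 1; rewrite // wii scaler0 addr0.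
pose t' := if 0 < dot eta (ray l) then (dot eta (ray l))^-1 else 1.
have t'0 : 0 < t' by rewrite /t'; case: ifP => // l0; rewrite invr_gt0.
(* t' is the end of the edge towards ray l, if there is one *)
exists t' => //; rewrite vE; apply/(cut_line_in t' li); split; first exact: ltW.
rewrite /t'; case: ifP => [l0|/negbT]; first by rewrite mulVf ?gt_eqF.
by rewrite mul1r -leNgt => /le_trans; exact.
Qed.

Definition cut_unit j : R := (Num.sqrt (dot (cut_dir i j) (cut_dir i j)))^-1.

Lemma cut_unit_gt0 j : j != i -> 0 < cut_unit j.
Proof. by move=> ji; rewrite invr_gt0 sqrtr_gt0 dot_gt0 // cut_dir_neq0. Qed.

(** The edge is exposed by the sum of the coordinates other than i and j and
    of the slack of H. *)
Lemma new_edge_exists j : j != i ->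
  new_edge Hbar o H (ray i) (cut_vertex i, cut_unit j *: cut_dir i j).
Proof.
move=> ji; have mu0 := cut_unit_gt0 ji; set mu := cut_unit j in mu0 *.
have onH (t : R) : hset H (cut_vertex i + t *: (mu *: cut_dir i j)).
  rewrite /cut_vertex -addrA; apply/hset_cutfun => //.
  by rewrite dotDr !dotZr mulVf // cut_dir_eta !mulr0 addr0.
split => /=.
- by exists (dot eta (ray i))^-1; rewrite // invr_ge0 ltW.
- by have := onH 0; rewrite scale0r addr0.
- split.
  + rewrite dotZl dotZr mulrA -expr2 exprVn sqr_sqrtr ?dot_ge0 //.
    by rewrite mulVf // gt_eqF // dot_gt0 // cut_dir_neq0.
  + pose F := \sum_(l | (l != i) && (l != j)) dual l - eta.
    exists (Hyperplane F (dot F o - 1)).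
    have FE w : dot F w = \sum_(l | (l != i) && (l != j)) dot (dual l) w - dot eta w.
      by rewrite dotBl dot_suml.
    have ge0 w : basis_cone Hbar (o + w) ->
        0 <= \sum_(l | (l != i) && (l != j)) dot (dual l) w.
      by move=> /(basis_coneP Nunit ho) w0; exact: sumr_ge0.
    split => [x|]; first rewrite -(subrKC o x).
      move=> [xc /hspace_cutfun-/(_ Ho) xH]; rewrite /hspace /= dotDr lerD2l FE.
      by have := ge0 _ xc; lra.
    apply/seteqP; split => x [Qx xE]; split => //.
      have [s s0 ->] := xE; rewrite /hset /= /cut_vertex -addrA dotDr; congr (_ + _).
      rewrite FE dotDr !dotZr mulVf // cut_dir_eta !mulr0 addr0.
      rewrite big1 ?add0r // => l /andP[li lj].
      rewrite dotDr !dotZr cut_dirE dotBr dotZr !dual_ray // (negPf li) (negPf lj).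
      by rewrite !mulr0 subr0 !mulr0 addr0.
    move: Qx xE; rewrite -(subrKC o x); set w := x - o => -[wc /hspace_cutfun-/(_ Ho) wH].
    rewrite /hset /= dotDr => /addrI; rewrite FE => Fw.
    have sum0 : \sum_(l | (l != i) && (l != j)) dot (dual l) w = 0.
      by have := ge0 _ wc; lra.
    have etaw : dot eta w = 1 by lra.
    have w0 := (basis_coneP Nunit ho _).1 wc.
    have wE : w = dot (dual i) w *: ray i + dot (dual j) w *: ray j.
      rewrite {1}(coord_decomp Nunit w) (bigD1 i) //= (bigD1 j) //= big1 ?addr0 // => l lij.
      move/eqP: sum0; rewrite psumr_eq0 // => /allP/(_ l).
      by rewrite mem_index_enum lij => /(_ isT)/eqP ->; rewrite scale0r.
    exists (dot (dual j) w / mu); first by rewrite divr_ge0 // ltW.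
    rewrite scalerA divfK ?gt_eqF // cut_lineE; congr (_ + _).
    rewrite {1}wE; congr (_ *: _ + _); apply/(mulIf etai0); rewrite divfK //.
    by move: etaw; rewrite {1}wE dotDr !dotZr; lra.
  + exact: cut_vertex_in.
  + pose t' := if 0 < dot eta (ray j) then (dot eta (ray j))^-1 else 1.
    have t'0 : 0 < t' by rewrite /t'; case: ifP => // l0; rewrite invr_gt0.
    exists (t' / mu); first by rewrite divr_gt0.
    rewrite scalerA divfK ?gt_eqF //; apply/(cut_line_in t' ji); split; first exact: ltW.
    rewrite /t'; case: ifP => [l0|/negbT]; first by rewrite mulVf ?gt_eqF.
    by rewrite mul1r -leNgt => /le_trans; exact.
- by move=> x [_ [t _ ->]].
Qed.

End AtVertex.

End NewEdges.

(** * What an activation adds *)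

Section CutEdges.
Context {R : realType} {n : nat}.
Local Notation vec := 'cV[R]_n.
Variables (Hbar : 'I_n -> hyperplane R n) (o : vec) (S : set vec).
Hypothesis Nunit : \matrix_(i, j) normal (Hbar i) j 0 \in unitmx.
Hypothesis ho : forall i, hset (Hbar i) o.
Hypotheses (Scl : closed S) (Scv : convex_set S) (So : S° o).
Local Notation ray := (ray Hbar).
Local Notation dual := (dual Hbar).
Implicit Types (w d v p : vec) (i j l : 'I_n).

Lemma not_defining i l : ~ defining Hbar o (ray i) l -> l = i.
Proof.
move=> nd; apply: contrapT => /eqP li; apply: nd => x [t t0 ->].
by apply/(hset_dual Nunit ho); rewrite dotZr dual_ray // (negPf li) mulr0.
Qed.

Lemma not_defining_self i : ~ defining Hbar o (ray i) i.
Proof.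
move=> di; have /di/(hset_dual Nunit ho) : halfline o (ray i) (o + 1 *: ray i).
  by exists 1; rewrite ?ler01.
by rewrite scale1r dual_ray // eqxx => /eqP; rewrite oner_eq0.
Qed.

Section AtHyperplane.
Variable H : hyperplane R n.
Hypothesis Ho : offset H < dot (normal H) o.
Local Notation eta := (cutfun o H).
Local Notation Q := (basis_cone Hbar `&` hspace H).
Local Notation cut i := (cut_before o S H (ray i)).
Local Notation vtx := (cut_vertex Hbar o H).
Local Notation dir := (cut_dir Hbar o H).

Lemma cut_eta_gt0 i : cut i -> 0 < dot eta (ray i).
Proof. by move/cut_before_dir; rewrite (dir_violates_cutfun Ho). Qed.

Lemma cut_vertex_interior i : cut i -> S° (vtx i).
Proof. exact: cut_before_interior. Qed.

Lemma edge_cut_dirP i j (mu : R) x : 0 < dot eta (ray i) -> j != i -> 0 < mu ->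
  edge Q (vtx i) (mu *: dir i j) x <->
  exists t, [/\ 0 <= t, t * dot eta (ray j) <= 1 & x = vtx i + t *: dir i j].
Proof.
move=> i0 ji mu0; split => [[+ [t t0 xE]]|[t [t0 t1 xE]]].
  rewrite xE scalerA => /(cut_line_in Nunit ho Ho i0 _ ji)[tm0 tm1].
  by exists (t * mu).
split; first by rewrite xE; apply/(cut_line_in Nunit ho Ho i0 _ ji).
by exists (t / mu); rewrite ?divr_ge0 ?(ltW mu0) // scalerA divfK ?gt_eqF.
Qed.

Lemma cut_line_end i j : 0 < dot eta (ray i) -> 0 < dot eta (ray j) ->
  vtx i + (dot eta (ray j))^-1 *: dir i j = o + (dot eta (ray j))^-1 *: ray j.
Proof.
by move=> i0 j0; rewrite cut_lineE // mulVf ?gt_eqF // subrr mul0r scale0r add0r.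
Qed.

(** Outside the facets that contain ray i, the edge can only reach facet i, at
    the point where ray j meets H. If it got there without crossing the
    boundary of S, this point would be interior to S, and ray j would be cut. *)
Lemma not_blocked_uncut i j (mu : R) : cut i -> ~~ cut j -> 0 < mu ->
  ~ blocked Hbar o S H (ray i) (vtx i, mu *: dir i j).
Proof.
move=> ci cj mu0 [l [x [/= /not_defining -> xe xi segx]]].
have i0 := cut_eta_gt0 ci.
have ji : j != i by apply: contraNneq cj => ->.
have /(edge_cut_dirP _ i0 ji mu0)[t [t0 _ xE]] := xe.
have te : t * dot eta (ray j) = 1.
  move: xi; rewrite xE cut_lineE // => /(hset_dual Nunit ho).
  rewrite dual2 // eqxx eq_sym (negPf ji) mulr0 addr0 mulr1 => /eqP.
  by rewrite mulf_eq0 invr_eq0 (gt_eqF i0) orbF subr_eq0 => /eqP.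
have j0 : 0 < dot eta (ray j).
  have tn0 : t != 0 by apply: contra_eq_neq te => ->; rewrite mul0r eq_sym oner_neq0.
  by rewrite -(pmulr_rgt0 _ (x := t)) ?te // lt0r tn0.
move/negP: cj; apply; apply: interior_cut_before => //.
apply: contrapT => nSx.
have tE : t = (dot eta (ray j))^-1 by rewrite -[t](mulfK (lt0r_neq0 j0)) te mul1r.
have [|s /andP[s0 s1] bs] := segment_crosses_bd Scl Scv (cut_vertex_interior ci) (y := x).
  by rewrite xE tE cut_line_end.
suff : (segment (vtx i) x `&` bd S) (vtx i + s *: (x - vtx i)) by rewrite segx.
by split => //; exists s => //; rewrite (ltW s0).
Qed.

(** If eta were positive on ray j, the edge would end on ray j, and, not
    meeting the boundary of S, it would be blocked there. *)
Lemma unblocked_ray_eta i j (mu : R) : cut i -> j != i -> 0 < mu ->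
  ~ blocked Hbar o S H (ray i) (vtx i, mu *: dir i j) ->
  edge Q (vtx i) (mu *: dir i j) `&` bd S = set0 -> dot eta (ray j) <= 0.
Proof.
move=> ci ji mu0 nb nbd; have i0 := cut_eta_gt0 ci.
rewrite leNgt; apply/negP => j0; apply: nb.
set x := vtx i + (dot eta (ray j))^-1 *: dir i j.
exists i, x; split => /=; first exact: not_defining_self.
- apply/edge_cut_dirP => //; exists (dot eta (ray j))^-1.
  by rewrite invr_ge0 (ltW j0) mulVf ?gt_eqF.
- rewrite /x cut_line_end //; apply/(hset_dual Nunit ho).
  by rewrite dotZr dual_ray // eq_sym (negPf ji) mulr0.
- apply/eqP/negPn/negP => /set0P[y [[s /andP[s0 s1] yE] by_]].
  suff : (edge Q (vtx i) (mu *: dir i j) `&` bd S) y by rewrite nbd.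
  split => //; apply/edge_cut_dirP => //; exists (s / dot eta (ray j)).
  rewrite divr_ge0 ?(ltW j0) // divfK ?gt_eqF //; split => //.
  by rewrite yE /x [_ + _ - vtx i]addrAC subrr add0r scalerA.
Qed.

(** The only additions that matter for validity: in each plane spanned by an
    activated ray i and an uncut ray j, either a boundary point of S on H, or
    a recession direction of S parallel to H. *)
Lemma new_element i j : cut i -> ~~ cut j ->
  (exists s t v d, [/\ 0 < t, dot eta (s *: ray i + t *: ray j) = 1 &
     added_point Hbar o S H (ray i) ((v, d), o + (s *: ray i + t *: ray j))]) \/
  (exists s t v, [/\ 0 < t, dot eta (s *: ray i + t *: ray j) = 0,
     recession S (s *: ray i + t *: ray j) &
     added_ray Hbar o S H (ray i) (v, s *: ray i + t *: ray j)]).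
Proof.
move=> ci cj; have i0 := cut_eta_gt0 ci.
have ji : j != i by apply: contraNneq cj => ->.
have mu0 := cut_unit_gt0 o Nunit H ji.
set mu := cut_unit Hbar o H i j in mu0.
have ne := new_edge_exists Nunit ho Ho i0 ji; rewrite -/mu in ne.
have nb := not_blocked_uncut ci cj mu0.
have [eb|/set0P[p [pe pb]]] :=
    eqVneq (edge Q (vtx i) (mu *: dir i j) `&` bd S) set0; [right|left].
  have dE : mu *: dir i j = (- (mu * (dot eta (ray j) / dot eta (ray i)))) *: ray i
      + mu *: ray j.
    by rewrite cut_dirE; vec_ring.
  exists (- (mu * (dot eta (ray j) / dot eta (ray i)))), mu, (vtx i).
  rewrite -dE; split => //; first by rewrite dotZr cut_dir_eta ?mulr0.
  have j0 := unblocked_ray_eta ci ji mu0 nb eb.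
  apply: (recession_ray Scl Scv (cut_vertex_interior ci)) => t t0 bt.
  suff : (edge Q (vtx i) (mu *: dir i j) `&` bd S) (vtx i + t *: (mu *: dir i j)).
    by rewrite eb.
  split => //; apply/edge_cut_dirP => //; exists (t * mu).
  rewrite scalerA mulr_ge0 ?(ltW mu0) //; split => //.
  by rewrite (@le_trans _ _ 0) // mulr_ge0_le0 // mulr_ge0 ?(ltW mu0).
have /(edge_cut_dirP _ i0 ji mu0)[t [t0 t1 pE]] := pe.
have tgt0 : 0 < t.
  rewrite lt0r t0 andbT; apply: contraPneq pb => t00.
  rewrite pE t00 scale0r addr0 => /(bdP Scl)[_]; apply; exact: cut_vertex_interior.
exists ((1 - t * dot eta (ray j)) / dot eta (ray i)), t, (vtx i), (mu *: dir i j).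
split => //; last by rewrite -cut_lineE // -pE.
by rewrite dotDr !dotZr divfK ?gt_eqF // subrK.
Qed.

End AtHyperplane.
End CutEdges.

(** * The loop over the activated rays *)

Section Loop.
Context {R : realType} {n : nat}.
Local Notation vec := 'cV[R]_n.
Variables (Hbar : 'I_n -> hyperplane R n) (o : vec) (S : set vec).
Variables (H : hyperplane R n) (RA : seq vec).
Implicit Types (C : collection R n) (r : vec).

Lemma new_edge_parallel r v d : new_edge Hbar o H r (v, d) ->
  hset H v /\ dot (normal H) d = 0.
Proof.
move=> [_ /= vH [_ _ Qv [t t0 Qt]] eH]; split => //.
have /eH : edge (basis_cone Hbar `&` hspace H) v d (v + t *: d).
  by split => //; exists t => //; rewrite ltW.
rewrite /hset /= dotDr vH -[RHS]addr0 => /addrI/eqP.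
by rewrite dotZr mulf_eq0 gt_eqF //= => /eqP.
Qed.

(** New elements lie on H, so they do not violate it. *)
Lemma added_point_kept r r' q : added_point Hbar o S H r q ->
  ~ removed_point Hbar o H RA r' q.
Proof.
by move=> [[_ _ _ eH] _ [/eH qH _]] [+ _ _]; rewrite qH ltxx.
Qed.

Lemma added_ray_kept r r' e : added_ray Hbar o S H r e ->
  ~ removed_ray Hbar o H RA r' e.
Proof.
by case: e => v d [/new_edge_parallel[_ d0] _ _] [+ _ _]; rewrite d0 ltxx.
Qed.

Local Notation step := (PHA1_step Hbar o S H RA).

Let foldl_point (rs : seq vec) C q : points (foldl step C rs) q ->
  points C q \/ exists r, [/\ r \in rs, cut_before o S H r &
                            added_point Hbar o S H r q].
Proof.
elim: rs C => [|r rs IH] C /=; first by left.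
move=> /IH[|[r' [r'rs cr' ar']]]; last first.
  by right; exists r'; rewrite inE r'rs orbT.
rewrite /PHA1_step; case: ifP => [cr [[Cq _]|ar]|_]; [by left| |by left].
by right; exists r; rewrite mem_head.
Qed.

Lemma PHA1_point C q : points (PHA1 Hbar o S H RA C) q ->
  points C q \/ exists r, [/\ r \in RA, cut_before o S H r &
                            added_point Hbar o S H r q].
Proof. exact: foldl_point. Qed.

Let foldl_ray (rs : seq vec) C e : rays (foldl step C rs) e ->
  rays C e \/ exists r, [/\ r \in rs, cut_before o S H r &
                            added_ray Hbar o S H r e].
Proof.
elim: rs C => [|r rs IH] C /=; first by left.
move=> /IH[|[r' [r'rs cr' ar']]]; last first.
  by right; exists r'; rewrite inE r'rs orbT.
rewrite /PHA1_step; case: ifP => [cr [[Ce _]|ar]|_]; [by left| |by left].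
by right; exists r; rewrite mem_head.
Qed.

Lemma PHA1_ray C e : rays (PHA1 Hbar o S H RA C) e ->
  rays C e \/ exists r, [/\ r \in RA, cut_before o S H r &
                            added_ray Hbar o S H r e].
Proof. exact: foldl_ray. Qed.

Let foldl_keeps_point (rs : seq vec) C q : points C q ->
  (forall r, r \in rs -> cut_before o S H r -> ~ removed_point Hbar o H RA r q) ->
  points (foldl step C rs) q.
Proof.
elim: rs C => [//|r rs IH] C Cq nrem /=; apply: IH => [|r' r'rs]; last first.
  by apply: nrem; rewrite inE r'rs orbT.
rewrite /PHA1_step; case: ifP => // cr; left; split => //.
by apply: nrem => //; rewrite mem_head.
Qed.

Let foldl_keeps_ray (rs : seq vec) C e : rays C e ->
  (forall r, r \in rs -> cut_before o S H r -> ~ removed_ray Hbar o H RA r e) ->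
  rays (foldl step C rs) e.
Proof.
elim: rs C => [//|r rs IH] C Cq nrem /=; apply: IH => [|r' r'rs]; last first.
  by apply: nrem; rewrite inE r'rs orbT.
rewrite /PHA1_step; case: ifP => // cr; left; split => //.
by apply: nrem => //; rewrite mem_head.
Qed.

Lemma PHA1_keeps_point C q : points C q ->
  (forall r, r \in RA -> cut_before o S H r -> ~ removed_point Hbar o H RA r q) ->
  points (PHA1 Hbar o S H RA C) q.
Proof. exact: foldl_keeps_point. Qed.

Lemma PHA1_keeps_ray C e : rays C e ->
  (forall r, r \in RA -> cut_before o S H r -> ~ removed_ray Hbar o H RA r e) ->
  rays (PHA1 Hbar o S H RA C) e.
Proof. exact: foldl_keeps_ray. Qed.

Let foldl_adds_point (rs : seq vec) C r q : cut_before o S H r ->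
  added_point Hbar o S H r q -> r \in rs -> points (foldl step C rs) q.
Proof.
move=> cr aq; elim: rs C => [//|r' rs IH] C; rewrite inE.
move=> /predU1P[<-|rrs] /=; last exact: IH.
apply: foldl_keeps_point => [|r'' _ _]; last exact: added_point_kept aq.
by rewrite /PHA1_step cr; right.
Qed.

Lemma PHA1_adds_point C r q : r \in RA -> cut_before o S H r ->
  added_point Hbar o S H r q -> points (PHA1 Hbar o S H RA C) q.
Proof. by move=> rRA cr aq; exact: foldl_adds_point cr aq rRA. Qed.

Let foldl_adds_ray (rs : seq vec) C r e : cut_before o S H r ->
  added_ray Hbar o S H r e -> r \in rs -> rays (foldl step C rs) e.
Proof.
move=> cr ae; elim: rs C => [//|r' rs IH] C; rewrite inE.
move=> /predU1P[<-|rrs] /=; last exact: IH.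
apply: foldl_keeps_ray => [|r'' _ _]; last exact: added_ray_kept ae.
by rewrite /PHA1_step cr; right.
Qed.

Lemma PHA1_adds_ray C r e : r \in RA -> cut_before o S H r ->
  added_ray Hbar o S H r e -> rays (PHA1 Hbar o S H RA C) e.
Proof. by move=> rRA cr ae; exact: foldl_adds_ray cr ae rRA. Qed.

End Loop.

(** * Shape of the collections built by activations *)

Section BuiltInvariant.
Context {R : realType} {n : nat}.
Local Notation vec := 'cV[R]_n.
Variables (Hbar : 'I_n -> hyperplane R n) (o : vec) (S P : set vec).
Hypothesis Nunit : \matrix_(i, j) normal (Hbar i) j 0 \in unitmx.
Hypothesis ho : forall i, hset (Hbar i) o.
Hypotheses (Scl : closed S) (Scv : convex_set S) (So : S° o).
Hypothesis Po : P o.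
Local Notation ray := (ray Hbar).
Local Notation dual := (dual Hbar).
Implicit Types (w d v p z : vec) (i j l : 'I_n) (H : hyperplane R n).

(** If the apex were on H, the cut vertex would be the apex, which lies on all
    facets of the cone, so that the edge would be blocked at once. *)
Lemma unblocked_new_edge_strict H i v d : hspace H o ->
  cut_before o S H (ray i) -> new_edge Hbar o H (ray i) (v, d) ->
  ~ blocked Hbar o S H (ray i) (v, d) -> offset H < dot (normal H) o.
Proof.
rewrite /hspace /= le_eqVlt => /predU1P[oH|//] ci [/= [t t0 vE] vH ed eH] nb.
have i0 := cut_before_dir ci.
have t00 : t = 0.
  move: vH; rewrite /hset /= vE dotDr -oH -[RHS]addr0 => /addrI/eqP.
  by rewrite dotZr mulf_eq0 (lt_eqF i0) orbF => /eqP.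
have {}vE : v = o by rewrite vE t00 scale0r addr0.
exfalso; apply: nb; exists i, o; split => /=.
- exact: not_defining_self.
- by split; [case: ed => _ _ + _; rewrite vE|exists 0; rewrite // vE scale0r addr0].
- exact: ho.
- apply/eqP/negPn/negP => /set0P[y [[s _ yE]]].
  by rewrite yE vE subrr scaler0 addr0 => /(bdP Scl)[].
Qed.

Definition in_cut_plane v z := exists i j t s u,
  [/\ 0 < t, j != i, v = o + t *: ray i & z = s *: ray i + u *: ray j].

Lemma in_cut_plane_edge v d (a : R) : in_cut_plane v d ->
  in_cut_plane v (v + a *: d - o).
Proof.
move=> [i [j [t [s [u [t0 ji vE dE]]]]]].
exists i, j, t, (t + a * s), (a * u); split => //.
by rewrite vE dE; vec_ring.
Qed.

Lemma unblocked_new_edge_plane H i v d : hspace H o ->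
  cut_before o S H (ray i) -> new_edge Hbar o H (ray i) (v, d) ->
  ~ blocked Hbar o S H (ray i) (v, d) -> S° v /\ in_cut_plane v d.
Proof.
move=> oH ci ne nb; have Ho := unblocked_new_edge_strict oH ci ne nb.
have i0 := cut_eta_gt0 Ho ci.
have [vE [j ji [mu mu0 dE]]] := new_edge_cut_dir Nunit ho Ho i0 ne.
split; first by rewrite vE; exact: cut_vertex_interior.
pose b := dot (cutfun o H) (ray j) / dot (cutfun o H) (ray i).
exists i, j, (dot (cutfun o H) (ray i))^-1, (- (mu * b)), mu.
split => //; first by rewrite invr_gt0.
by rewrite dE cut_dirE /b; vec_ring.
Qed.

(** What the proof needs of the history of a collection. An element that
    starts at the apex lies on a ray; any other one starts on a ray i and lies
    in a plane spanned by ray i and another ray. Starting vertices of recorded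
    rays are interior to S. Initial elements of rays that were never cut are
    still present. *)
Definition built_invariant (C : collection R n) (Rc : set vec) : Prop :=
  [/\ forall v d p, points C ((v, d), p) ->
        (v = o /\ exists l t, p = o + t *: ray l) \/ in_cut_plane v (p - o),
      forall v d, rays C (v, d) ->
        S° v /\ ((v = o /\ exists l, d = ray l) \/ in_cut_plane v d),
      forall l t, ~ Rc (ray l) -> 0 <= t -> bd S (o + t *: ray l) ->
        points C ((o, ray l), o + t *: ray l)
    & forall l, ~ Rc (ray l) -> (forall t, 0 <= t -> ~ bd S (o + t *: ray l)) ->
        rays C (o, ray l)].

Lemma ray_Rbar l : Rbar Hbar o (ray l).
Proof. by apply/(RbarP Nunit ho); exists l. Qed.

Lemma initial_invariant :
  built_invariant (initial_collection Hbar o S) set0.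
Proof.
split.
- move=> v d p [/= vo /(RbarP Nunit ho)[l dE] [t _ pE] _]; left; split => //.
  by exists l, t; rewrite pE dE.
- move=> v d [/= vo /(RbarP Nunit ho)[l dE] _].
  by rewrite vo; split => //; left; split => //; exists l.
- move=> l t _ t0 bt; split => //=; [exact: ray_Rbar|by exists t].
- move=> l _ nb; split => //=; first exact: ray_Rbar.
  by apply/eqP/negPn/negP => /set0P[y [[t t0 ->] /nb]]; exact.
Qed.

Lemma PHA1_invariant H RA C Rc : hspace H o ->
  (forall r, r \in RA -> Rbar Hbar o r) -> built_invariant C Rc ->
  built_invariant (PHA1 Hbar o S H RA C)
    (Rc `|` [set r | r \in RA /\ cut_before o S H r]).
Proof.
move=> oH RAbar [Ip Ir Kp Kr]; split.
- move=> v d p /PHA1_point[/Ip//|[r [/RAbar/(RbarP Nunit ho)[i ->] ci [ne nb]]]].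
  move=> [[/= _ [a _ pE]] _]; right.
  have [_ vd] := unblocked_new_edge_plane oH ci ne nb.
  by rewrite pE; exact: in_cut_plane_edge.
- move=> v d /PHA1_ray[/Ir//|[r [/RAbar/(RbarP Nunit ho)[i ->] ci [ne nb _]]]].
  by have [Sv vd] := unblocked_new_edge_plane oH ci ne nb; split; last right.
- move=> l t nc t0 bt; apply: PHA1_keeps_point => [|r rRA cr].
    by apply: Kp => // Rcl; apply: nc; left.
  move=> [/= viol _ nex]; have [lRA|lRA] := boolP (ray l \in RA); last first.
    by apply: nex; exists (ray l); split => //; [exact: ray_Rbar|exists t].
  have cl : ~~ cut_before o S H (ray l) by apply/negP => cl; apply: nc; right.
  by move: viol; rewrite ltNge (uncut_bd_point Scl Scv So oH cl t0 bt).
- move=> l nc nb; apply: PHA1_keeps_ray => [|r rRA cr].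
    by apply: Kr => // Rcl; apply: nc; left.
  move=> [/= viol _ nex]; have [lRA|lRA] := boolP (ray l \in RA); last first.
    by apply: nex; exists (ray l); split => //; exact: ray_Rbar.
  have cl : ~~ cut_before o S H (ray l) by apply/negP => cl; apply: nc; right.
  by move: viol; rewrite ltNge (uncut_bd_ray cl nb).
Qed.

Lemma built_has_invariant C Rc : built Hbar o S P C Rc -> built_invariant C Rc.
Proof.
elim=> [|{}C {}Rc H RA _ IH [_ PH] RAbar]; first exact: initial_invariant.
by apply: PHA1_invariant => //; exact: PH.
Qed.

End BuiltInvariant.

(** * Activations preserve point-ray collections *)

Section PointRay.
Context {R : realType} {n : nat}.
Local Notation vec := 'cV[R]_n.
Variables (Hbar : 'I_n -> hyperplane R n) (o : vec) (S P : set vec).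
Hypothesis Nunit : \matrix_(i, j) normal (Hbar i) j 0 \in unitmx.
Hypothesis ho : forall i, hset (Hbar i) o.
Hypotheses (Scl : closed S) (Scv : convex_set S) (So : S° o).
Variables (H : hyperplane R n) (RA : seq vec).
Hypothesis Ho : offset H < dot (normal H) o.
Hypothesis RAbar : forall r, r \in RA -> Rbar Hbar o r.
Hypotheses (Pcone : P `<=` basis_cone Hbar) (PH : P `<=` hspace H).
Local Notation ray := (ray Hbar).
Local Notation Q := (basis_cone Hbar `&` hspace H).
Local Notation vtx := (cut_vertex Hbar o H).
Local Notation dir := (cut_dir Hbar o H).
Implicit Types (w d v p z : vec) (i j l : 'I_n).

Lemma cut_polyhedron : polyhedron Q.
Proof.
exists n.+1, (fun i : 'I_n.+1 => if unlift ord0 i is Some j then Hbar j else H).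
apply/seteqP; split => x; first by move=> [xc xH] i; case: unliftP.
move=> xG; split=> [i|]; last by have := xG ord0; rewrite unlift_none.
by have := xG (lift (@ord0 n) i); rewrite liftK.
Qed.

Lemma cut_relaxation : relaxation P Q.
Proof.
by split; [exact: cut_polyhedron|move=> x Px; split; [exact: Pcone|exact: PH]].
Qed.

Let std_edge i j : vec * vec := (vtx i, cut_unit Hbar o H i j *: dir i j).

(** The edges that leave the cut vertex inside H are indexed by the other
    rays, hence finitely many; each of them meets the boundary of S at most
    once. *)
Lemma new_edge_std i e : cut_before o S H (ray i) ->
  new_edge Hbar o H (ray i) e -> range (std_edge i) e.
Proof.
case: e => v d ci ne; have i0 := cut_eta_gt0 Ho ci.
have [-> [j ji [mu mu0 dE]]] := new_edge_cut_dir Nunit ho Ho i0 ne.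
exists j => //; congr pair; rewrite dE; congr (_ *: _).
apply: (unit_scale_inj (v := dir i j)) => //; first exact: cut_unit_gt0.
  by have [_ _ []] := new_edge_exists Nunit ho Ho i0 ji.
by rewrite -dE; have [_ _ []] := ne.
Qed.

Lemma added_rays_finite i : cut_before o S H (ray i) ->
  finite_set [set e | added_ray Hbar o S H (ray i) e].
Proof.
move=> ci; apply: (sub_finite_set (B := range (std_edge i))).
  by move=> e [/(new_edge_std ci)].
exact/finite_image/finite_finset.
Qed.

Lemma added_points_finite i : cut_before o S H (ray i) ->
  finite_set [set q | added_point Hbar o S H (ray i) q].
Proof.
move=> ci; pose hit (e : vec * vec) := xget 0 (halfline e.1 e.2 `&` bd S).
apply: (sub_finite_set (B := range (fun j => (std_edge i j, hit (std_edge i j))))).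
  move=> [e p] [/= ne _ [[_ pe] pb]].
  have [j _ eE] := new_edge_std ci ne; exists j => //; rewrite eE; congr pair.
  rewrite /hit; case: xgetP => [y _ [[s s0 yE] yb]|/(_ p)]; last by case.
  have [t t0 pE] := pe; rewrite yE pE; congr (_ + _ *: _).
  rewrite yE in yb; rewrite pE in pb.
  apply: (bd_ray_uniq Scl Scv _ s0 t0 yb pb).
  by rewrite -eE /=; exact: cut_vertex_interior.
exact/finite_image/finite_finset.
Qed.

Lemma finite_over_cut (T : Type) (A : vec -> set T) :
  (forall i, cut_before o S H (ray i) -> finite_set (A (ray i))) ->
  finite_set [set q | exists r, [/\ r \in RA, cut_before o S H r & A r q]].
Proof.
move=> Afin; rewrite (_ : [set q | _] =
  \bigcup_(r in [set r | r \in RA]) [set q | cut_before o S H r /\ A r q]).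
  apply: bigcup_finite => [|r /RAbar/(RbarP Nunit ho)[i ->]].
    exact: finite_seq.
  have [ci|nci] := boolP (cut_before o S H (ray i)); last first.
    by rewrite (_ : [set q | _] = set0) ?finite_set0 //; apply/seteqP; split => q // [].
  by apply: sub_finite_set (Afin i ci) => q [].
by apply/seteqP; split=> q [r]; [move=> [rA cr Aq]|move=> rA [cr Aq]]; exists r.
Qed.

Lemma PHA1_point_ray_collection C :
  point_ray_collection Hbar o S P C ->
  point_ray_collection Hbar o S P (PHA1 Hbar o S H RA C).
Proof.
move=> [[finP finR] Cp Cr]; split.
- split.
    apply: (sub_finite_set (B := points C `|`
        [set q | exists r, [/\ r \in RA, cut_before o S H r & added_point Hbar o S H r q]])).
      by move=> q /PHA1_point.
    by rewrite finite_setU; split => //; exact: finite_over_cut added_points_finite.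
  apply: (sub_finite_set (B := rays C `|`
      [set q | exists r, [/\ r \in RA, cut_before o S H r & added_ray Hbar o S H r q]])).
    by move=> q /PHA1_ray.
  by rewrite finite_setU; split => //; exact: finite_over_cut added_rays_finite.
- move=> v d p /PHA1_point[/Cp//|[r [rRA cr [ne nb [pe pb]]]]].
  split=> //; first by have [[]] := pe.
  by exists Q; split => //; [exact: cut_relaxation|case: ne].
- move=> v d /PHA1_ray[/Cr//|[r [rRA cr [ne nb nbd]]]].
  have [i rE] := (RbarP Nunit ho r).1 (RAbar rRA); rewrite {}rE in ne nb cr nbd.
  have i0 := cut_eta_gt0 Ho cr.
  have [vE [j ji [mu mu0 dE]]] := new_edge_cut_dir Nunit ho Ho i0 ne.
  rewrite /= vE dE in nb nbd.
  have j0 := unblocked_ray_eta Nunit ho Ho cr ji mu0 nb nbd.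
  split.
    move=> _ [t t0 ->]; apply/(basis_coneP Nunit ho) => l.
    rewrite dE cut_dirE !(dotZr, dotBr) !dual_ray // !mulr_ge0 ?(ltW mu0) //.
    rewrite subr_ge0 (le_trans (y := 0)) ?ler0n //.
    by rewrite mulr_le0_ge0 ?ler0n // mulr_le0_ge0 // invr_ge0 ltW.
  exists Q; split; rewrite ?vE ?dE //; first exact: cut_relaxation.
    by rewrite -vE -dE; case: ne.
  apply/seteqP; split => [x []//|x [t t0 ->]]; apply/(edge_cut_dirP Nunit ho Ho) => //.
  exists (t * mu); rewrite mulr_ge0 ?(ltW mu0) // scalerA; split => //.
  by rewrite (@le_trans _ _ 0) // mulr_ge0_le0 // mulr_ge0 ?(ltW mu0).
Qed.

End PointRay.

(** * Activations preserve properness *)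

Section Properness.
Context {R : realType} {n : nat}.
Local Notation vec := 'cV[R]_n.
Variables (Hbar : 'I_n -> hyperplane R n) (o : vec) (S P : set vec).
Hypothesis Nunit : \matrix_(i, j) normal (Hbar i) j 0 \in unitmx.
Hypothesis ho : forall i, hset (Hbar i) o.
Hypotheses (Scl : closed S) (Scv : convex_set S) (So : S° o).
Variables (H : hyperplane R n) (R' : seq vec) (C : collection R n) (Rc : set vec).
Hypothesis Ho : offset H < dot (normal H) o.
Hypothesis R'cut : forall r, r \in R' -> Rbar_cut Hbar o S H r.
Hypothesis RcR' : forall r, Rc r -> Rbar_cut Hbar o S H r -> r \in R'.
Hypothesis Cinv : built_invariant Hbar o S C Rc.
Hypothesis Cpr : point_ray_collection Hbar o S P C.
Local Notation ray := (ray Hbar).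
Local Notation dual := (dual Hbar).
Local Notation eta := (cutfun o H).
Local Notation cut i := (cut_before o S H (ray i)).
Local Notation C' := (PHA1 Hbar o S H R' C).
Implicit Types (w d v p z f s : vec) (i j l : 'I_n) (a b t : R).

(** The rays on which the tilting moves the intersection with H outwards, to
    the boundary of S. *)
Definition relaxed j := cut j && (ray j \notin R').

Definition tilt_coef j : R :=
  if relaxed j then (if dist_bd o S (ray j) is t%:E then t^-1 else 0)
  else dot eta (ray j).

(** The level set 1 of this functional is the tilted hyperplane: its value on
    a ray is the inverse of the signed distance at which the hyperplane
    crosses the line of the ray, and 0 if both are parallel. *)
Definition tilt : vec := locked (\sum_j tilt_coef j *: dual j).

Lemma tilt_ray j : dot tilt (ray j) = tilt_coef j.
Proof.
rewrite /tilt -lock dot_suml (bigD1 j) //= big1 => [|l lj].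
  by rewrite dotZl dual_ray // eqxx mulr1 addr0.
by rewrite dotZl dual_ray // (negPf lj) mulr0.
Qed.

Lemma R'_cut i : ray i \in R' -> cut i.
Proof. by case/R'cut. Qed.

Lemma cut_not_relaxed j : cut j -> ~~ relaxed j -> ray j \in R'.
Proof. by rewrite /relaxed => ->; rewrite negbK. Qed.

Lemma tilt_coef_R' i : ray i \in R' -> tilt_coef i = dot eta (ray i).
Proof. by rewrite /tilt_coef /relaxed => ->; rewrite andbF. Qed.

Lemma tilt_coef_uncut i : ~~ cut i -> tilt_coef i = dot eta (ray i).
Proof. by rewrite /tilt_coef /relaxed => /negPf ->. Qed.

(** A relaxed ray has never been cut and is not activated now, so its initial
    element belongs to the new collection. *)
Lemma relaxedP j : relaxed j ->
  (exists2 t, 0 < t & [/\ bd S (o + t *: ray j), tilt_coef j = t^-1 &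
                points C' ((o, ray j), o + t *: ray j)]) \/
  [/\ recession S (ray j), tilt_coef j = 0 & rays C' (o, ray j)].
Proof.
move=> rj; have /andP[cj jR'] := rj; have [_ _ Kp Kr] := Cinv.
have nRc : ~ Rc (ray j).
  move=> Rcj; move/negP: jR'; apply; apply: RcR' => //.
  by split => //; exact: ray_Rbar.
have [[t t0 bt]|nb] := pselect (exists2 t, 0 <= t & bd S (o + t *: ray j)).
  left; exists t.
    rewrite lt0r t0 andbT; apply: contraPneq bt => ->.
    by rewrite scale0r addr0 => /(bdP Scl)[].
  split => //; first by rewrite /tilt_coef rj (dist_bd_fin Scl Scv So t0 bt).
  apply: PHA1_keeps_point; first exact: Kp.
  move=> r _ _ [_ _]; apply; exists (ray j); split => //; first exact: ray_Rbar.
  by exists t.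
have {}nb t : 0 <= t -> ~ bd S (o + t *: ray j) by move=> t0 bt; apply: nb; exists t.
right; split.
- exact: recession_ray So nb.
- by rewrite /tilt_coef rj dist_bd_infty.
- apply: PHA1_keeps_ray; first exact: Kr.
  by move=> r _ _ [_ _]; apply; exists (ray j); split => //; exact: ray_Rbar.
Qed.

(** A relaxed ray meets H before it meets the boundary of S, so that tilting
    decreases the inverse distance. Therefore the tilted hyperplane is still
    valid for every set that H leaves on the side of the apex. *)
Lemma tilt_coef_le j : tilt_coef j <= dot eta (ray j).
Proof.
have [rj|nrj] := boolP (relaxed j); last by rewrite /tilt_coef (negPf nrj).
have /andP[cj _] := rj; have j0 := cut_eta_gt0 Ho cj.
have Sj := cut_before_interior Scl Scv So Ho cj.
case: (relaxedP rj) => [[t t0 [bt -> _]]|[_ -> _]]; last exact: ltW.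
rewrite invf_ple ?posrE // leNgt; apply/negP => tj.
have /(bdP Scl)[_] := bt; apply.
by apply: (interior_before Scv So (interior_subset Sj)); rewrite ltW.
Qed.

Lemma tilt_le z : (forall l, 0 <= dot (dual l) z) -> dot tilt z <= dot eta z.
Proof.
move=> z0; rewrite (dot_decomp Nunit tilt) (dot_decomp Nunit eta).
by apply: ler_sum => j _; rewrite tilt_ray ler_wpM2l // tilt_coef_le.
Qed.

Lemma same_origin i k v t : 0 < t -> v = o + t *: ray i ->
  halfline o (ray k) v -> k = i.
Proof.
move=> t0 -> [t' _ /addrI/(congr1 (dot (dual i)))]; rewrite !dotZr !dual_ray // eqxx.
case: eqVneq => // _ /eqP; rewrite mulr0 mulr1 => /eqP t00.
by rewrite t00 ltxx in t0.
Qed.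

(** Common form of the two facts that an element disappears only if it is
    removed for one of the activated rays. *)
Lemma not_kept (K : Prop) (removed : vec -> Prop) :
  ((forall r, r \in R' -> cut_before o S H r -> ~ removed r) -> K) -> ~ K ->
  exists2 k, ray k \in R' & removed (ray k).
Proof.
move=> keep nK; apply: contrapT => nex; apply: nK; apply: keep => r rR' _ rem.
have [/(RbarP Nunit ho)[k rE] _] := R'cut rR'; apply: nex; exists k; by rewrite -rE.
Qed.

(** A point that starts at the apex originates from every ray, but it is
    removed only if the ray it lies on is activated: this gives a degenerate
    plane, with j = i and b = 0. *)
Lemma removed_point_plane v d p : points C ((v, d), p) -> ~ points C' ((v, d), p) ->
  exists i j a b, [/\ ray i \in R', 0 <= a, 0 <= b,
    p = o + (a *: ray i + b *: ray j) & 1 < dot eta (a *: ray i + b *: ray j)].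
Proof.
move=> Cp /(not_kept (PHA1_keeps_point Cp))[k kR' [/= viol org nex]].
have [Ip _ _ _] := Cinv; have [_ Cp' _] := Cpr; have [_ pc _] := Cp' _ _ _ Cp.
have [[vo [l [t pE]]]|] := Ip _ _ _ Cp.
  have t0 : 0 <= t.
    move: pc; rewrite pE => /(basis_coneP Nunit ho)/(_ l).
    by rewrite dotZr dual_ray // eqxx mulr1.
  exists l, l, t, 0; rewrite scale0r addr0; split => //.
    apply: contrapT => /negP lR'; apply: nex; exists (ray l).
    by split => //; [exact: ray_Rbar|exists t].
  by rewrite -violates_cutfun // -pE.
move=> [i [j [t [a [b [t0 ji vE /esym/eqP]]]]]]; rewrite eq_sym subr_eq addrC => /eqP pE.
have ki := same_origin t0 vE org; rewrite ki in kR'.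
move: pc; rewrite pE => /(basis_coneP Nunit ho) pc.
have := pc i; have := pc j; rewrite !dual2 // !eqxx (negPf ji) eq_sym (negPf ji).
rewrite !mulr0 !mulr1 addr0 add0r => b0 a0.
by exists i, j, a, b; split => //; rewrite -violates_cutfun // -pE.
Qed.

Lemma removed_ray_plane v d : rays C (v, d) -> ~ rays C' (v, d) ->
  exists i j a b, [/\ ray i \in R', 0 <= a, 0 <= b,
    d = a *: ray i + b *: ray j & 0 < dot eta d].
Proof.
move=> Cr /(not_kept (PHA1_keeps_ray Cr))[k kR' [/= viol org nex]].
rewrite (dir_violates_cutfun Ho) in viol.
have [_ Ir _ _] := Cinv; have [_ _ Cr'] := Cpr; have [dc _] := Cr' _ _ Cr.
have [_ [[vo [l dE]]|]] := Ir _ _ Cr.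
  exists l, l, 1, 0; rewrite scale0r addr0 scale1r; split => //.
  apply: contrapT => /negP lR'; apply: nex; exists (ray l).
  by split => //; exact: ray_Rbar.
move=> [i [j [t [a [b [t0 ji vE dE]]]]]].
have ki := same_origin t0 vE org; rewrite ki in kR'.
have /dc/(basis_coneP Nunit ho) {}dc : halfline o d (o + 1 *: d) by exists 1; rewrite ?ler01.
have := dc i; have := dc j; rewrite scale1r dE !dual2 // !eqxx (negPf ji) eq_sym (negPf ji).
rewrite !mulr0 !mulr1 addr0 add0r => b0 a0.
by exists i, j, a, b; split => //; rewrite -dE.
Qed.

Lemma rescale_ray i a : cut i ->
  a *: ray i = (a * dot eta (ray i)) *: ((dot eta (ray i))^-1 *: ray i).
Proof. by move=> /(cut_eta_gt0 Ho) i0; rewrite scalerA mulfK // gt_eqF. Qed.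

(** If ray j is not relaxed, tilt and eta agree on the plane. If it is relaxed
    and the value of tilt were less than 1, the point would be a combination,
    with weights of sum less than 1, of the interior point where ray i meets H
    and of the boundary point on ray j; it would be interior to S. When ray j
    does not leave S, the boundary point is replaced by a recession direction. *)
Lemma tilt_ge1 i j a b : ray i \in R' -> 0 <= a -> 0 <= b ->
  1 < dot eta (a *: ray i + b *: ray j) ->
  bd S (o + (a *: ray i + b *: ray j)) -> 1 <= dot tilt (a *: ray i + b *: ray j).
Proof.
move=> iR' a0 b0; rewrite !dotDr !dotZr !tilt_ray (tilt_coef_R' iR') => eta1 bz.
have [rj|] := boolP (relaxed j); last first.
  by rewrite /tilt_coef => /negPf ->; exact: ltW.
have ci := R'_cut iR'; have i0 := cut_eta_gt0 Ho ci.
have Si := cut_before_interior Scl Scv So Ho ci.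
rewrite leNgt; apply/negP => lt1; have /(bdP Scl)[_] := bz; apply.
have aE := rescale_ray a ci.
have ai0 : 0 <= a * dot eta (ray i) by rewrite mulr_ge0 // ltW.
case: (relaxedP rj) lt1 => [[t t0 [/(bdP Scl)[St _] -> _]]|[rec -> _]] lt1.
  have bE : b *: ray j = (b / t) *: (t *: ray j) by rewrite scalerA divfK // gt_eqF.
  rewrite aE bE; apply: star_interior => //; first exact: interior_subset.
  by rewrite divr_ge0 // ltW.
rewrite addrA aE; apply: (recession_interior rec _ b0).
have := star_interior Scv So (interior_subset Si) (interior_subset Si) ai0 (lexx 0).
by rewrite scale0r !addr0; apply; rewrite mulr0 addr0 in lt1.
Qed.

Lemma tilt_ge0 i j a b : ray i \in R' -> 0 <= a -> 0 <= b ->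
  0 < dot eta (a *: ray i + b *: ray j) -> 0 <= dot tilt (a *: ray i + b *: ray j).
Proof.
move=> iR' a0 b0; rewrite !dotDr !dotZr !tilt_ray (tilt_coef_R' iR') => eta0.
have [rj|] := boolP (relaxed j); last first.
  by rewrite /tilt_coef => /negPf ->; exact: ltW.
have i0 := cut_eta_gt0 Ho (R'_cut iR').
rewrite addr_ge0 // mulr_ge0 // ?(ltW i0) //.
by case: (relaxedP rj) => [[t t0 [_ -> _]]|[_ -> _]] //; rewrite invr_ge0 ltW.
Qed.

Section ValidFunctional.
Variable f : vec.
Hypothesis fpoint : forall e p, points C' (e, p) -> 1 <= dot f (p - o).
Hypothesis fray : forall e, rays C' e -> 0 <= dot f e.2.

Lemma tilt_coef_le_relaxed j : relaxed j -> tilt_coef j <= dot f (ray j).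
Proof.
case/relaxedP => [[t t0 [_ -> /fpoint]]|[_ -> /fray //]].
by rewrite (addrC o) addrK dotZr mulrC -ler_pdivrMr // mul1r.
Qed.

Lemma new_plane_element i j : ray i \in R' -> ~~ cut j ->
  exists a t, let z := a *: ray i + t *: ray j in 0 < t /\
    ([/\ dot eta z = 1, 1 <= dot f z & bd S (o + z)] \/
     [/\ dot eta z = 0, 0 <= dot f z & recession S z]).
Proof.
move=> iR' cj; have ci := R'_cut iR'.
have [[a [t [v [d [t0 z1 ap]]]]]|[a [t [v [t0 z0 rz ar]]]]] :=
    new_element Nunit ho Scl Scv So Ho ci cj; exists a, t; split => //.
  left; have [_ _ [_ bz]] := ap; split => //.
  by have := PHA1_adds_point C iR' ci ap => /fpoint; rewrite (addrC o) addrK.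
by right; split => //; exact: fray (PHA1_adds_ray C iR' ci ar).
Qed.

(** Suppose f z < eta z. Since f >= eta on ray i, f < eta on ray j. The new
    element z' of the plane satisfies f z' >= eta z', so it is closer to ray i
    than z is: z' = A z + B (ray i) with A and B positive. As eta z is greater
    than 1 and eta z' is at most 1, the point z' is a combination of z and of
    the point where ray i meets H with weights of sum less than 1, hence
    interior to S. If z is a direction, it is a recession direction added to a
    point interior to S; if z' is a direction, eta z' = 0 is impossible. *)
Lemma uncut_no_removed i j a b : ray i \in R' -> ~~ cut j ->
  dot eta (ray i) <= dot f (ray i) -> 0 <= a -> 0 <= b ->
  let z := a *: ray i + b *: ray j in
  1 < dot eta z /\ S (o + z) \/ 0 < dot eta z /\ recession S z ->
  dot eta z <= dot f z.
Proof.
move=> iR' cj fi a0 b0 z Hz; rewrite leNgt; apply/negP => fz.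
have ci := R'_cut iR'; have i0 := cut_eta_gt0 Ho ci.
have Si := cut_before_interior Scl Scv So Ho ci.
have zE u : dot u z = a * dot u (ray i) + b * dot u (ray j).
  by rewrite dotDr !dotZr.
have bgt0 : 0 < b.
  rewrite lt0r b0 andbT; apply: contraTneq fz => b00.
  by rewrite !zE b00 !mul0r !addr0 -leNgt ler_wpM2l.
have zgt0 : 0 < dot eta z by case: Hz => [[/(lt_trans ltr01)]|[]].
have [c [t [t0 z'P]]] := new_plane_element iR' cj.
set z' := c *: ray i + t *: ray j in z'P.
have fz' : dot eta z' <= dot f z' by case: z'P => [[->]|[->]].
pose A := t / b; pose B := c - a * A.
have A0 : 0 < A by rewrite divr_gt0.
have z'E : z' = A *: z + B *: ray i.
  rewrite /z' /z /B /A; vec_field; exact: lt0r_neq0.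
have B0 : 0 < B.
  move: fz'; rewrite z'E !dotDr !dotZr -subr_ge0 => ge0.
  have {ge0} : A * (dot eta z - dot f z) <= B * (dot f (ray i) - dot eta (ray i)) by lra.
  rewrite ltNge => ge0; apply/negP => B0.
  have : B * (dot f (ray i) - dot eta (ray i)) <= 0 by rewrite mulr_le0_ge0 ?subr_ge0.
  have : 0 < A * (dot eta z - dot f z) by rewrite mulr_gt0 ?subr_gt0.
  lra.
have etaz' : dot eta z' = A * dot eta z + B * dot eta (ray i).
  by rewrite z'E dotDr !dotZr.
clearbody A B z z'.
case: z'P => [[z'1 _ /(bdP Scl)[_ nSz']]|[z'0 _ _]]; last first.
  by move/eqP: etaz'; rewrite z'0 eq_sym gt_eqF // addr_gt0 // mulr_gt0.
have BE := rescale_ray B ci.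
have Bi0 : 0 <= B * dot eta (ray i) by exact: mulr_ge0 (ltW B0) (ltW i0).
have eq1 : A * dot eta z + B * dot eta (ray i) = 1 by rewrite -etaz'.
apply: nSz'; rewrite z'E BE; case: Hz => [[z1 Sz]|[z0 rz]].
  apply: star_interior => //; [exact: interior_subset|exact: ltW|].
  by rewrite -[ltRHS]eq1 ltrD2r ltr_pMr.
rewrite [X in o + X]addrC addrA; apply: (recession_interior rz _ (ltW A0)).
have := star_interior Scv So (interior_subset Si) (interior_subset Si) Bi0 (lexx 0).
rewrite scale0r !addr0; apply.
by rewrite -eq1 ltrDr mulr_gt0.
Qed.

Section NoViolation.
Hypothesis feta : forall i, ray i \in R' -> dot eta (ray i) <= dot f (ray i).

(** When f cuts at least as deep as H on the activated rays, the coefficients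
    of f are at least those of tilt except perhaps on uncut rays, which
    uncut_no_removed handles. *)
Lemma removed_le i j a b : ray i \in R' -> 0 <= a -> 0 <= b ->
  let z := a *: ray i + b *: ray j in
  1 < dot eta z /\ S (o + z) \/ 0 < dot eta z /\ recession S z ->
  dot tilt z <= dot f z.
Proof.
move=> iR' a0 b0 z Hz.
have [cj|cj] := boolP (cut j); last first.
  have := uncut_no_removed iR' cj (feta iR') a0 b0 Hz.
  by rewrite /z !dotDr !dotZr !tilt_ray tilt_coef_R' // tilt_coef_uncut.
rewrite /z !dotDr !dotZr !tilt_ray lerD // ler_wpM2l //.
  by rewrite tilt_coef_R' // feta.
have [/tilt_coef_le_relaxed//|/(cut_not_relaxed cj) jR'] := boolP (relaxed j).
by rewrite tilt_coef_R' // feta.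
Qed.

Lemma valid_before_point e p : points C (e, p) -> 1 <= dot f (p - o).
Proof.
move=> Cp; have [/fpoint//|nCp] := pselect (points C' (e, p)).
case: e Cp nCp => v d Cp /(removed_point_plane Cp)[i [j [a [b [iR' a0 b0 pE z1]]]]].
have [_ Cp' _] := Cpr; have [pb _ _] := Cp' _ _ _ Cp; rewrite pE in pb.
rewrite pE (addrC o) addrK.
apply: le_trans (tilt_ge1 iR' a0 b0 z1 pb) (removed_le iR' a0 b0 _).
by left; split => //; case/(bdP Scl): pb.
Qed.

Lemma C_ray_recession v d : rays C (v, d) -> recession S d.
Proof.
move=> Cr; have [_ Ir _ _] := Cinv; have [Sv _] := Ir _ _ Cr.
have [_ _ Cr'] := Cpr; have [_ [Q [_ _ eQ nb]]] := Cr' _ _ Cr.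
apply: (recession_ray Scl Scv Sv) => t t0 bt.
suff : (edge Q v d `&` bd S) (v + t *: d) by rewrite nb.
by split => //; rewrite eQ; exists t.
Qed.

Lemma valid_before_ray e : rays C e -> 0 <= dot f e.2.
Proof.
case: e => v d Cr; have [/fray//|nCr] := pselect (rays C' (v, d)).
have [i [j [a [b [iR' a0 b0 dE d0]]]]] := removed_ray_plane Cr nCr.
have rd := C_ray_recession Cr; rewrite /= dE; rewrite dE in d0 rd.
apply: le_trans (tilt_ge0 iR' a0 b0 d0) (removed_le iR' a0 b0 _).
by right.
Qed.

End NoViolation.

Section Violation.
Variable k : 'I_n.
Hypotheses (kR' : ray k \in R') (fk : dot f (ray k) < dot eta (ray k)).
Variable s : vec.
Hypothesis sS : forall y, S y -> dot s (y - o) <= 1.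

Lemma polar_lt_eta j : cut j -> dot s (ray j) < dot eta (ray j).
Proof.
move=> cj; have j0 := cut_eta_gt0 Ho cj.
have := polar_interior sS (cut_before_interior Scl Scv So Ho cj).
by rewrite dotZr mulrC ltr_pdivrMr // mul1r.
Qed.

Lemma polar_le_tilt j : cut j -> dot s (ray j) <= tilt_coef j.
Proof.
move=> cj; have [rj|] := boolP (relaxed j); last first.
  by rewrite /tilt_coef => /negPf ->; exact/ltW/polar_lt_eta.
case: (relaxedP rj) => [[t t0 [/(bdP Scl)[St _] -> _]]|[rec -> _]].
  by have := polar_le1 sS St; rewrite dotZr mulrC -ler_pdivlMr // mul1r.
exact: (polar_recession sS (interior_subset So)).
Qed.

(** It suffices to compare coefficients. On a cut ray, s <= tilt because the
    tilted hyperplane crosses it inside S; the inequality then follows from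
    tilt <= f, except on the activated rays with f < eta, where it bounds c
    from above. Let c be the least of these bounds, attained on ray i. On an
    uncut ray j, the new element z of the plane of rays i and j has s z <= eta
    z <= f z; since the inequality is an equality on ray i, subtracting gives
    it on ray j. *)
Lemma tilt_interpolation : exists2 c : R, 0 < c &
  forall z, (forall l, 0 <= dot (dual l) z) ->
    dot s z <= dot tilt z + c * (dot f z - dot tilt z).
Proof.
pose bad i := (ray i \in R') && (dot f (ray i) < dot eta (ray i)).
pose F i := (dot eta (ray i) - dot s (ray i)) / (dot eta (ray i) - dot f (ray i)).
have badk : bad k by rewrite /bad kR'.
case: (@arg_minP _ _ _ k bad F badk) => i /andP[iR' fi] imin.
have ci := R'_cut iR'.
have c0 : 0 < F i by rewrite divr_gt0 // subr_gt0 // polar_lt_eta.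
exists (F i) => // z z0.
rewrite (dot_decomp Nunit s) (dot_decomp Nunit tilt) (dot_decomp Nunit f).
rewrite -sumrB mulr_sumr -big_split /=; apply: ler_sum => j _.
rewrite -mulrBr mulrCA -mulrDr ler_wpM2l // tilt_ray.
have [/andP[jR' fj]|nbj] := boolP (bad j).
  have : F i <= F j by apply: imin; rewrite /bad jR'.
  rewrite {2}/F ler_pdivlMr ?subr_gt0 // tilt_coef_R' //; lra.
have [cj|cj] := boolP (cut j).
  have fj : tilt_coef j <= dot f (ray j).
    have [/tilt_coef_le_relaxed//|/(cut_not_relaxed cj) jR'] := boolP (relaxed j).
    by move: nbj; rewrite /bad jR' -leNgt tilt_coef_R'.
  by rewrite (le_trans (polar_le_tilt cj)) // lerDl mulr_ge0 ?(ltW c0) // subr_ge0.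
rewrite tilt_coef_uncut //.
have [a [t [t0 fz sz]]] : exists a t, [/\ 0 < t,
    dot eta (a *: ray i + t *: ray j) <= dot f (a *: ray i + t *: ray j) &
    dot s (a *: ray i + t *: ray j) <= dot eta (a *: ray i + t *: ray j)].
  have [a [t [t0 zP]]] := new_plane_element iR' cj; exists a, t; split => //.
    by case: zP => [[->]|[->]].
  case: zP => [[-> _ /(bdP Scl)[Sz _]]|[-> _ rz]]; first exact: polar_le1 sS _ Sz.
  exact: (polar_recession sS (interior_subset So)).
have cE : F i * (dot eta (ray i) - dot f (ray i)) = dot eta (ray i) - dot s (ray i).
  by rewrite divfK // gt_eqF // subr_gt0.
move: fz sz; rewrite !dotDr !dotZr => fz sz.
rewrite -lerBlDl -(ler_pM2l t0).
have h1 : t * (dot s (ray j) - dot eta (ray j)) <=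
   a * (F i * (dot eta (ray i) - dot f (ray i))) by rewrite cE; lra.
apply: (le_trans h1).
have h2 : a * (dot eta (ray i) - dot f (ray i)) <=
   t * (dot f (ray j) - dot eta (ray j)) by lra.
by rewrite mulrCA [leRHS]mulrCA ler_pM2l.
Qed.

End Violation.

Variable PI : set vec.
Hypothesis PIcone : PI `<=` basis_cone Hbar.
Hypothesis PIH : PI `<=` hspace H.
Hypothesis PIfree : forall x, PI x -> ~ S° x.
Hypothesis Cproper : forall g,
  (forall e p, points C (e, p) -> 1 <= dot g (p - o)) ->
  (forall e, rays C e -> 0 <= dot g e.2) ->
  forall x, PI x -> 1 <= dot g (x - o).

(** If f < eta on no activated ray, f is valid for the old collection.
    Otherwise a point x with f x < 1 is not interior to S; s supports S at x,
    and tilt_interpolation bounds s by (1 - c) tilt + c f. For c <= 1 this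
    contradicts s x >= 1. For c > 1 the combination g of f and s dominates
    tilt on the cone, hence is valid for the removed elements; it is valid for
    the kept ones since s <= 1 <= f there; and g x < f x < 1 contradicts
    properness. *)
Lemma PHA1_valid x : PI x -> 1 <= dot f (x - o).
Proof.
move=> PIx.
have [[k [kR' fk]]|nv] :=
    pselect (exists i, ray i \in R' /\ dot f (ray i) < dot eta (ray i)); last first.
  have feta i : ray i \in R' -> dot eta (ray i) <= dot f (ray i).
    by move=> iR'; rewrite leNgt; apply/negP => fi; apply: nv; exists i.
  apply: Cproper PIx => [e p Cp|e Cr]; first exact: (valid_before_point feta Cp).
  exact: (valid_before_ray feta Cr).
rewrite leNgt; apply/negP => fx.
have [s [sS sx]] := supporting_functional Scl Scv So (PIfree PIx).
have [c c0 sle] := tilt_interpolation kR' fk sS.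
have xc : forall l, 0 <= dot (dual l) (x - o).
  by apply/(basis_coneP Nunit ho); rewrite subrKC; exact: PIcone.
have tx : dot tilt (x - o) <= 1.
  apply: le_trans (tilt_le xc) _.
  by apply/(hspace_cutfun Ho); rewrite subrKC; exact: PIH.
have sxle := sle _ xc.
have [c1|c1] := leP c 1.
  have : c * (dot f (x - o) - 1) < 0 by rewrite pmulr_rlt0 // subr_lt0.
  have : 0 <= (1 - c) * (1 - dot tilt (x - o)) by rewrite mulr_ge0 // subr_ge0.
  lra.
have c10 : 0 < c - 1 by rewrite subr_gt0.
pose g := f + (c - 1)^-1 *: (f - s).
have gE z : dot g z = dot f z + (dot f z - dot s z) / (c - 1).
  by rewrite dotDl dotZl dotBl mulrC.
have gtilt z : (forall l, 0 <= dot (dual l) z) -> dot tilt z <= dot g z.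
  move=> /sle sz; rewrite gE -lerBlDl ler_pdivlMr //; lra.
suff /(_ x PIx) : forall x, PI x -> 1 <= dot g (x - o).
  rewrite gE leNgt => /negP; apply.
  rewrite -[ltRHS]addr0 ltrD // pmulr_llt0 ?invr_gt0 // subr_lt0.
  exact: lt_le_trans fx sx.
have [_ Cp Cr] := Cpr.
apply: Cproper => [[v d] p Cvp|[v d] Cvd].
  have [pb pc _] := Cp _ _ _ Cvp.
  have [/fpoint fp|nCp] := pselect (points C' ((v, d), p)).
    have /sS sp : S p by case/(bdP Scl): pb.
    by rewrite gE (le_trans fp) // lerDl divr_ge0 ?(ltW c10) // subr_ge0 (le_trans sp).
  have [i [j [a [b [iR' a0 b0 pE z1]]]]] := removed_point_plane Cvp nCp.
  rewrite pE in pb pc *; rewrite (addrC o) addrK.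
  apply: le_trans (tilt_ge1 iR' a0 b0 z1 pb) (gtilt _ _).
  exact/(basis_coneP Nunit ho).
have rd := C_ray_recession Cvd.
have [/fray /= fd|nCd] := pselect (rays C' (v, d)).
  have sd := polar_recession sS (interior_subset So) rd.
  by rewrite /= gE addr_ge0 // divr_ge0 ?(ltW c10) // subr_ge0 (le_trans sd).
have [i [j [a [b [iR' a0 b0 dE d0]]]]] := removed_ray_plane Cvd nCd.
rewrite dE in d0; rewrite /= dE; apply: le_trans (tilt_ge0 iR' a0 b0 d0) (gtilt _ _).
rewrite -dE; apply/(basis_coneP Nunit ho).
have [dc _] := Cr _ _ Cvd; rewrite -[d]scale1r; apply: dc.
by exists 1; rewrite ?ler01.
Qed.

End ValidFunctional.

End Properness.

Theorem theorem11 (R : realType) (m n : nat)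
    (A : 'M[rat]_(m, n)) (b : 'cV[rat]_m) (c : 'cV[rat]_n) (I : {set 'I_n})
    (nb : 'I_n -> 'I_m + 'I_n) (xbar : 'cV[R]_n) (S : set 'cV[R]_n)
    (P_full : full_dimensional (feasible_set R A b))
    (P_pointed : pointed (feasible_set R A b))
    (xbar_opt : optimal_basic_feasible A b c nb xbar)
    (S_closed : closed S)
    (S_convex : convex_set S)
    (S_free : forall x, mixed_int R A b I x -> ~ S° x)
    (xbar_int : S° xbar)
    (* H is one of the hyperplanes defining P *)
    (k : 'I_m + 'I_n)
    (H_nz : normal (constr R A b k) != 0)
    (xbar_notin_H : ~ hset (constr R A b k) xbar)
    (* the current collection and the rays previously cut *)
    (C : collection R n) (Rc : set 'cV[R]_n)
    (C_built : built (nonbasic_hyperplanes R A b nb) xbar S (feasible_set R A b) C Rc)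
    (R' : seq 'cV[R]_n)
    (R'_cut : forall r, r \in R' ->
       Rbar_cut (nonbasic_hyperplanes R A b nb) xbar S (constr R A b k) r)
    (Rc_R' : forall r, Rc r ->
       Rbar_cut (nonbasic_hyperplanes R A b nb) xbar S (constr R A b k) r ->
       r \in R')
    (Ht : hyperplane R n)
    (Ht_tilt : targeted_tilting (nonbasic_hyperplanes R A b nb) xbar S
                 (constr R A b k) R' Ht)
    (C_proper : proper_collection (nonbasic_hyperplanes R A b nb) xbar S
                  (feasible_set R A b) (mixed_int R A b I) C) :
  proper_collection (nonbasic_hyperplanes R A b nb) xbar S
    (feasible_set R A b) (mixed_int R A b I)
    (PHA1 (nonbasic_hyperplanes R A b nb) xbar S (constr R A b k) R' C).
Proof.
have [[xbar_feas Nunit ho] _] := xbar_opt.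
set Hbar := nonbasic_hyperplanes R A b nb in Nunit ho *.
set P := feasible_set R A b in xbar_feas *.
set H := constr R A b k in H_nz xbar_notin_H *.
have Pcone : P `<=` basis_cone Hbar by move=> x Px i; exact: Px.
have PH : P `<=` hspace H by move=> x Px; exact: Px.
have Ho : offset H < dot (normal H) xbar.
  rewrite lt_neqAle; have -> : offset H <= dot (normal H) xbar by exact: PH.
  by rewrite andbT; apply/eqP => /esym/xbar_notin_H.
have Cinv := built_has_invariant Nunit ho S_closed S_convex xbar_int xbar_feas C_built.
have [Cpr Cval] := C_proper.
split.
  by apply: PHA1_point_ray_collection => // r /R'_cut[].
have scaled (al x : 'cV[R]_n) (be : R) : dot al xbar < be ->
    (be <= dot al x) = (1 <= dot ((be - dot al xbar)^-1 *: al) (x - xbar)).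
  move=> albe; rewrite dotZl ler_pdivlMl ?subr_gt0 // mulr1 dotBr.
  by rewrite lerD2r.
move=> al be alP alR albe x PIx; rewrite scaled //.
apply: (PHA1_valid Nunit ho S_closed S_convex xbar_int Ho R'_cut Rc_R' Cinv Cpr
  _ _ _ _ S_free _ PIx).
- by move=> e p Cp; rewrite -scaled //; exact: alP Cp.
- move=> e Ce; rewrite dotZl mulr_ge0 ?invr_ge0 ?(alR e) //.
  by rewrite ltW // subr_gt0.
- by move=> y [Py _]; exact: Pcone.
- by move=> y [Py _]; exact: PH.
move=> g gP gR y PIy.
have := Cval g (1 + dot g xbar).
have E z : (1 + dot g xbar <= dot g z) = (1 <= dot g (z - xbar)).
  by rewrite dotBr lerBrDr.
rewrite -E; apply => // [e p /gP|]; first by rewrite E.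
by rewrite ltrDr ltr01.
Qed.
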